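(* Let $H$ be a nonzero complex Hilbert space and let $V\subseteq\{\xi\in H:\|\xi\|=1\}$ be a norm-closed set satisfying V1: $\lambda\cdot V\subseteq V$ for every $\lambda\in\mathbb C$ with $|\lambda|=1$; and V2: for $\xi\in H$, if $\langle\xi,\eta\rangle=0$ for all $\eta\in V$ then $\xi=0$. The function $E:\mathcal B(H)_*\to[0,+\infty]$ satisfies: (i) For all $\rho_1,\rho_2\in\mathcal B(H)_*$, $E(\rho_1+\rho_2)\le E(\rho_1)+E(\rho_2)$. (ii) For every nonzero $\lambda\in\mathbb C$ and every $\rho\in\mathcal B(H)_*$, $E(\lambda\cdot\rho)=|\lambda|\cdot E(\rho)$. (iii) $E$ is lower semicontinuous relative to the weak$^*$ topology of $\mathcal B(H)_*$. (iv) If $r(V)>0$, then $E$ is a norm equivalent to the norm of $\mathcal B(H)_*$. Moreover, letting $\Sigma$ be the set of all normal states of $\mathcal B(H)$, $$\sup_{\rho\in\Sigma}E(\rho)=\sup_{X\in\mathcal B}\|X\|=\frac1{r(V)^2},$$ the right side being interpreted as $+\infty$ when $r(V)=0$.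
   Context: $\mathcal B(H)_*$ is the Banach space of normal linear functionals on $\mathcal B(H)$; its weak$^*$ topology is that obtained by identifying it with the dual of the $C^*$-algebra $\mathcal K$ of compact operators on $H$. Let $\mathcal A=\{K+\lambda\mathbf 1:K\in\mathcal K,\ \lambda\in\mathbb C\}$. For $X\in\mathcal B(H)$ let $\|X\|_V=\sup_{\xi,\eta\in V}|\langle X\xi,\eta\rangle|$, and let $\mathcal B=\{X\in\mathcal A:\|X\|_V\le1\}$. Define $E(\rho)=\sup_{X\in\mathcal B}|\rho(X)|\in[0,+\infty]$ for $\rho\in\mathcal B(H)_*$. The inner radius $r(V)$ is the largest $r\ge0$ such that $\{\xi\in H:\|\xi\|\le r\}$ is contained in the closed convex hull of $V$. *)

(* Defs.v *)
From HB Require Import structures.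
From mathcomp Require Import all_boot all_order all_algebra.
From mathcomp Require Import complex sesquilinear.
From mathcomp Require Import all_classical all_reals all_analysis.

Set Implicit Arguments.
Unset Strict Implicit.
Unset Printing Implicit Defensive.

Import Order.TTheory GRing.Theory Num.Theory.
Import numFieldNormedType.Exports.

Local Open Scope classical_set_scope.
Local Open Scope ring_scope.

HB.mixin Record isHilbert (R : realType) H & NormedModule R[i] H := {
  inner : {dot H for Num.conj} ;
  normr_inner : forall x : H, `|x| ^+ 2 = inner x x
}.

#[short(type="hilbertType")]
HB.structure Definition Hilbert (R : realType) :=
  {H of isHilbert R H & CompleteNormedModule R[i] H}.

(* The norms of R[i] and of H take their values in R[i]; this is the same
   number as an element of R. *)
Definition rnorm (R : realType) (U : normedZmodType R[i]) (x : U) : R :=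
  complex.Re `|x|.

Section BoundedOperators.
Variables (R : realType) (H : hilbertType R).

Definition bounded_operator : {pred H -> H} :=
  mem [set f : H -> H | linear f /\ continuous f].

Record bop := Bop { bop_val :> H -> H ; _ : bop_val \in bounded_operator }.

HB.instance Definition _ := [isSub for bop_val].
HB.instance Definition _ := [Choice of bop by <:].

Lemma bounded_operator_submod : submod_closed bounded_operator.
Proof.
split=> [|a f g]; rewrite !inE.
  split=> [b u v|]; first by rewrite /= scaler0 addr0.
  exact: cst_continuous.
move=> [lf cf] [lg cg]; split=> [b u v|x].
  rewrite !fctE lf lg !scalerDr !scalerA (mulrC a) -!addrA; congr (_ + _).
  by rewrite addrCA.
by apply: continuousD; [exact/continuousZl_tmp/cf|exact: cg].
Qed.

HB.instance Definition _ :=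
  GRing.isSubmodClosed.Build R[i] (H -> H) bounded_operator
    bounded_operator_submod.
HB.instance Definition _ := [SubChoice_isSubLmodule of bop by <:].

Lemma op1_subproof : (idfun : H -> H) \in bounded_operator.
Proof. by rewrite inE; split=> [a u v //|x]; exact: cvg_id. Qed.

Definition op1 : bop := Bop op1_subproof.

Definition opnorm (X : bop) : \bar R :=
  ereal_sup [set (rnorm (X x))%:E | x in [set x : H | `|x| <= 1]].

Definition compact_operator (X : bop) : Prop :=
  precompact (X @` [set x : H | `|x| <= 1]).

Definition positive_operator (X : bop) : Prop := forall x, 0 <= inner (X x) x.

End BoundedOperators.

Section Predual.
Variables (R : realType) (H : hilbertType R).
Local Notation C := (R[i]^o).

Definition square_summable (x : nat -> H) : Prop :=
  cvgn (series (fun n => rnorm (x n) ^+ 2)).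

(* The ultraweak (sigma-weak) topology of B(H) is the coarsest one that makes
   all the functionals X |-> \sum_n <X x_n, y_n> continuous, where (x_n) and
   (y_n) are square-summable. *)
Definition ultraweak_index : Type :=
  {p : (nat -> H) * (nat -> H) | square_summable p.1 /\ square_summable p.2}.

Definition ultraweak_eval (X : bop H) : {ptws ultraweak_index -> C} :=
  fun p => limn (series (fun n => inner (X ((sval p).1 n)) ((sval p).2 n) : C)).

Definition ultraweak : topologicalType := initial_topology ultraweak_eval.

(* A linear functional is normal iff it is ultraweakly continuous. *)
Definition normal_functional : {pred bop H -> C} :=
  mem [set rho : bop H -> C | linear rho /\ continuous (rho : ultraweak -> C)].

Record predual := Predual {
  predual_val :> bop H -> C ; _ : predual_val \in normal_functional }.

HB.instance Definition _ := [isSub for predual_val].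
HB.instance Definition _ := [Choice of predual by <:].

Lemma normal_functional_submod : submod_closed normal_functional.
Proof.
split=> [|a f g].
  apply/mem_set; split=> [b u v|]; first by rewrite /= scaler0 addr0.
  exact: cst_continuous.
move=> /set_mem[lf cf] /set_mem[lg cg]; apply/mem_set; split=> [b u v|x].
  rewrite !fctE lf lg !scalerDr !scalerA (mulrC a) -!addrA; congr (_ + _).
  by rewrite addrCA.
apply: (@continuousD _ C ultraweak (a \*: f) g).
  exact/continuousZl_tmp/cf.
exact: cg.
Qed.

HB.instance Definition _ :=
  GRing.isSubmodClosed.Build R[i] (bop H -> C) normal_functional
    normal_functional_submod.
HB.instance Definition _ := [SubChoice_isSubLmodule of predual by <:].

Definition predual_norm (rho : predual) : \bar R :=
  ereal_sup [set (rnorm (rho X))%:E | X in [set X | (opnorm X <= 1)%E]].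

(* The dual of the compact operators carries the topology of pointwise
   convergence on them. *)
Definition weak_star_eval (rho : predual) :
    {ptws {K : bop H | compact_operator K} -> C} :=
  fun K => rho (sval K).

Definition weak_star : topologicalType := initial_topology weak_star_eval.

Definition normal_state (rho : predual) : Prop :=
  (forall X, positive_operator X -> (0 : R[i]) <= rho X) /\ rho (op1 H) = 1.

Definition is_norm (N : predual -> R) : Prop :=
  [/\ forall rho, N rho = 0 -> rho = 0,
      forall (a : R[i]) rho, N (a *: rho) = rnorm a * N rho
    & forall rho1 rho2, N (rho1 + rho2) <= N rho1 + N rho2].

Definition equivalent_norms (N : predual -> R) : Prop :=
  exists c d : R, [/\ 0 < c, 0 < d &
    forall rho, (c%:E * predual_norm rho <= (N rho)%:E)%E /\
                ((N rho)%:E <= d%:E * predual_norm rho)%E].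

End Predual.

Section EntanglementNorm.
Variables (R : realType) (H : hilbertType R) (V : set H).

Definition unitized_compact : set (bop H) :=
  [set X | exists2 K, compact_operator K & exists a : R[i], X = K + a *: op1 H].

Definition seminormV (X : bop H) : \bar R :=
  ereal_sup [set (rnorm (inner (X x) y))%:E | x in V & y in V].

Definition ballV : set (bop H) :=
  [set X | unitized_compact X /\ (seminormV X <= 1)%E].

Definition entanglement_measure (rho : predual H) : \bar R :=
  ereal_sup [set (rnorm (rho X))%:E | X in ballV].

Definition closed_convex_hull : set H :=
  closure (smallest (@convex_set R[i] H) V).

(* The supremum is attained, since the closed convex hull is closed. *)
Definition inner_radius : R :=
  sup [set r : R | 0 <= r /\
                   [set x : H | rnorm x <= r] `<=` closed_convex_hull].

End EntanglementNorm.

(* Main.v *)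
(* An [X] with [|X|_V <= 1] is bounded by 1 on the closed convex hull of [V],
   hence [|X| <= 1 / t^2] whenever the hull contains the ball of radius [t].
   Conversely, for [s > r] a functional [<., w>] with [|w| = 1] separates a
   point of norm at most [s] from the hull, so that [s^-2 w w^*] lies in the
   unit ball of [|.|_V]; evaluating at the vector state of [w] gives both
   suprema and the norm equivalence.

   Semicontinuity needs more, since [rho |-> rho 1] is not weak* continuous:
   [K + a 1] must be replaced by a compact operator of almost the same
   [V]-norm and almost the same value under [rho].  We take [K + a T], with [T]
   the average of a long increasing chain [P_0 <= P_1 <= ...] of finite rank
   projections, where [P_(k+1)] fixes a finite subset of [V] whose image is a
   net in [P_k V].  Then [K + a P_k] is bounded by about
   [1 + |a| |P_(k+1) x - P_k x|] at [x] in [V], and orthogonality of the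
   increments makes the average of the errors small.  If [P_0] fixes enough
   vectors, [rho T] is close to [rho 1]. *)
Require Import Defs.
From mathcomp Require Import all_boot all_order all_algebra.
From mathcomp Require Import complex sesquilinear.
From mathcomp Require Import all_classical all_reals all_analysis.
From mathcomp Require Import ring lra.

Import Order.TTheory GRing.Theory Num.Theory.
Import numFieldNormedType.Exports.

Local Open Scope classical_set_scope.
Local Open Scope ring_scope.
Local Open Scope complex_scope.

Set Implicit Arguments.
Unset Strict Implicit.
Unset Printing Implicit Defensive.

(** * Real-valued norms and inner products *)

Section RealNorm.
Variable R : realType.

Section Zmod.
Variable U : normedZmodType R[i].
Implicit Types x y : U.

Lemma rnormE x : `|x| = (rnorm x)%:C.
Proof. by rewrite RRe_real// ger0_real. Qed.

Lemma rnorm_ge0 x : 0 <= rnorm x.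
Proof. by rewrite -ler0c -rnormE. Qed.

Lemma rnorm0 : rnorm (0 : U) = 0.
Proof. by rewrite /rnorm normr0. Qed.

Lemma rnormN x : rnorm (- x) = rnorm x.
Proof. by rewrite /rnorm normrN. Qed.

Lemma rnorm_distC x y : rnorm (x - y) = rnorm (y - x).
Proof. by rewrite /rnorm distrC. Qed.

Lemma rnormD x y : rnorm (x + y) <= rnorm x + rnorm y.
Proof. by rewrite -lecR rmorphD/= -!rnormE ler_normD. Qed.

Lemma rnormB x y : rnorm (x - y) <= rnorm x + rnorm y.
Proof. by rewrite (le_trans (rnormD _ _))// rnormN. Qed.

Lemma rnorm_eq0 x : (rnorm x == 0) = (x == 0).
Proof. by rewrite -(inj_eq (@complexI R)) -rnormE normr_eq0. Qed.

Lemma rnorm_gt0 x : (0 < rnorm x) = (x != 0).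
Proof. by rewrite lt_neqAle eq_sym rnorm_eq0 rnorm_ge0 andbT. Qed.

Lemma rnorm_le x (t : R) : (rnorm x <= t) = (`|x| <= t%:C).
Proof. by rewrite rnormE lecR. Qed.

Lemma rnorm_sum (I : Type) (s : seq I) (F : I -> U) :
  rnorm (\sum_(i <- s) F i) <= \sum_(i <- s) rnorm (F i).
Proof.
elim/big_ind2: _ => [|x a y b xa yb|//]; first by rewrite rnorm0.
by rewrite (le_trans (rnormD _ _))// lerD.
Qed.

End Zmod.

Lemma rnormM (a b : R[i]) : rnorm (a * b) = rnorm a * rnorm b.
Proof. by apply: complexI; rewrite rmorphM/= -!rnormE normrM. Qed.

Lemma rnormV (a : R[i]) : rnorm a^-1 = (rnorm a)^-1.
Proof. by apply: complexI; rewrite fmorphV/= -!rnormE normfV. Qed.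

Lemma rnormZ (U : normedModType R[i]) (a : R[i]) (x : U) :
  rnorm (a *: x) = rnorm a * rnorm x.
Proof. by apply: complexI; rewrite rmorphM/= -!rnormE normrZ. Qed.

Lemma rnorm_real (t : R) : rnorm (t%:C) = `|t|.
Proof. by rewrite /rnorm normc_def/= expr0n addr0 sqrtr_sqr. Qed.

Lemma rnorm_invn (n : nat) : rnorm (n%:R^-1 : R[i]) = n%:R^-1.
Proof.
by rewrite -(rmorph_nat (real_complex R)) -fmorphV rnorm_real ger0_norm.
Qed.

Lemma rnorm_conj (a : R[i]) : rnorm (Num.conj a) = rnorm a.
Proof. by rewrite /rnorm norm_conjC. Qed.

Lemma conj_realC (t : R) : Num.conj (t%:C : R[i]) = t%:C.
Proof. exact: conjc_real. Qed.

Lemma ltr0c (t : R) : (0 < t%:C :> R[i]) = (0 < t).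
Proof. exact: ltcR. Qed.

Lemma ler_normRe_rnorm (z : R[i]) : `|complex.Re z| <= rnorm z.
Proof. by rewrite -lecR -rnormE normc_ge_Re. Qed.

Lemma rnormi : rnorm ('i%C : R[i]) = 1.
Proof. by rewrite /rnorm normc_def/= expr0n expr1n add0r sqrtr1. Qed.

Lemma ler_normIm_rnorm (z : R[i]) : `|complex.Im z| <= rnorm z.
Proof.
have := ler_normRe_rnorm (z * 'i%C).
by rewrite ReiNIm normrN rnormM rnormi mulr1.
Qed.

Lemma ler_Re_rnorm (z : R[i]) : complex.Re z <= rnorm z.
Proof. exact: le_trans (ler_norm _) (ler_normRe_rnorm z). Qed.

Lemma rnorm_le1 (U : normedZmodType R[i]) (x : U) :
  (`|x| <= 1) = (rnorm x <= 1).
Proof. by rewrite rnorm_le. Qed.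

(** Expanding squares, positivity and separation only control real parts; multiplying by this [a]
    turns such bounds into bounds on moduli. *)
Lemma rnorm_phase (z : R[i]) : exists2 a, `|a| = 1 & a * z = (rnorm z)%:C.
Proof.
have [->|z0] := eqVneq z 0; first by exists 1; rewrite ?normr1// mulr0 rnorm0.
exists (`|z| / z); first by rewrite normrM normfV normr_id divff// normr_eq0.
by rewrite divfK// rnormE.
Qed.

End RealNorm.

(** * The inner product and the Cauchy-Schwarz inequality *)

Section InnerProduct.
Variables (R : realType) (H : hilbertType R).
Implicit Types x y z : H.

Lemma innerDl x y z : inner (x + y) z = inner x z + inner y z.
Proof. by rewrite linearDl. Qed.
Lemma innerDr x y z : inner z (x + y) = inner z x + inner z y.
Proof. by rewrite linearDr. Qed.
Lemma innerNl x z : inner (- x) z = - inner x z.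
Proof. by rewrite linearNl. Qed.
Lemma innerNr x z : inner z (- x) = - inner z x.
Proof. by rewrite linearNr. Qed.
Lemma innerBl x y z : inner (x - y) z = inner x z - inner y z.
Proof. by rewrite linearBl. Qed.
Lemma innerBr x y z : inner z (x - y) = inner z x - inner z y.
Proof. by rewrite linearBr. Qed.
Lemma innerZl a x z : inner (a *: x) z = a * inner x z.
Proof. by rewrite linearZl_LR. Qed.
Lemma innerZr a x z : inner z (a *: x) = Num.conj a * inner z x.
Proof. by rewrite linearZr_LR. Qed.
Lemma inner0l z : inner 0 z = 0. Proof. by rewrite linear0l. Qed.
Lemma inner0r z : inner z 0 = 0. Proof. by rewrite linear0r. Qed.
Lemma innerC x y : inner x y = Num.conj (inner y x).
Proof. by rewrite hermC expr0 mul1r. Qed.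

Lemma inner_suml (I : Type) (s : seq I) (F : I -> H) z :
  inner (\sum_(i <- s) F i) z = \sum_(i <- s) inner (F i) z.
Proof. by rewrite linear_sumlz. Qed.

Lemma inner_self x : inner x x = (rnorm x ^+ 2)%:C.
Proof. by rewrite -normr_inner rnormE rmorphXn. Qed.

Lemma rnormD_sqr x y :
  rnorm (x + y) ^+ 2 = rnorm x ^+ 2 + rnorm y ^+ 2 + 2 * complex.Re (inner x y).
Proof.
apply: complexI; rewrite -inner_self innerDl !innerDr !inner_self.
rewrite (innerC y x) -addrA (addrA (inner x y)) addcJ.
by rewrite !rmorphD !rmorphM/= rmorph_nat; ring.
Qed.

Lemma rnormB_sqr x y :
  rnorm (x - y) ^+ 2 = rnorm x ^+ 2 + rnorm y ^+ 2 - 2 * complex.Re (inner x y).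
Proof. by rewrite rnormD_sqr rnormN innerNr raddfN/= mulrN. Qed.

Lemma CauchySchwarz_rnorm x y : rnorm (inner x y) <= rnorm x * rnorm y.
Proof.
have [->|y0] := eqVneq y 0; first by rewrite inner0r !rnorm0 mulr0.
have py : 0 < rnorm y by rewrite rnorm_gt0.
have [a a1 ha] := rnorm_phase (inner x y).
have ra : rnorm a = 1 by rewrite /rnorm a1.
set c := rnorm (inner x y) in ha *.
have c0 : 0 <= c by exact: rnorm_ge0.
have e (t : R) : inner (a *: x) (t%:C *: y) = (t * c)%:C.
  by rewrite innerZl innerZr conj_realC mulrCA ha rmorphM.
(* The squared distance from [a *: x] to its projection on the line of [y] is nonnegative. *)
have := sqr_ge0 (rnorm (a *: x - (c / rnorm y ^+ 2)%:C *: y)).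
rewrite rnormB_sqr !rnormZ ra rnorm_real e /= mul1r.
rewrite ger0_norm ?divr_ge0 ?sqr_ge0//.
set X := rnorm x; set Y := rnorm y => h.
have X0 : 0 <= X by exact: rnorm_ge0.
rewrite -(ler_pXn2r (_ : 0 < 2)%N) ?nnegrE ?mulr_ge0 ?rnorm_ge0//.
rewrite exprMn -ler_pdivrMr ?exprn_gt0// -subr_ge0; apply: le_trans h _.
by rewrite le_eqVlt; apply/orP; left; apply/eqP; field; rewrite gt_eqF.
Qed.

Lemma rnorm_inner_le x y a b : rnorm x <= a -> rnorm y <= b ->
  rnorm (inner x y) <= a * b.
Proof.
move=> xa yb; rewrite (le_trans (CauchySchwarz_rnorm _ _))//.
by rewrite ler_pM ?rnorm_ge0.
Qed.

End InnerProduct.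

(** * Bounded and compact operators *)

Section Operators.
Variables (R : realType) (H : hilbertType R).
Implicit Types (X Y : bop H) (x y u v w : H).

Lemma bop_linear X : linear X.
Proof. by case: X => f /=; rewrite inE => -[]. Qed.

Lemma bop_continuous X : continuous X.
Proof. by case: X => f /=; rewrite inE => -[]. Qed.

Lemma bopD X x y : X (x + y) = X x + X y.
Proof. by rewrite -[x]scale1r bop_linear !scale1r. Qed.

Lemma bop0 X : X 0 = 0.
Proof. by apply: (addrI (X 0)); rewrite -bopD !addr0. Qed.

Lemma bopZ X a x : X (a *: x) = a *: X x.
Proof. by rewrite -[a *: x]addr0 bop_linear bop0 addr0. Qed.

Lemma bopB X x y : X (x - y) = X x - X y.
Proof. by rewrite -scaleN1r bopD bopZ scaleN1r. Qed.

Lemma bop_ext X Y : X =1 Y -> X = Y.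
Proof. by move=> e; apply/val_inj/funext. Qed.

Lemma add_bopE X Y x : (X + Y) x = X x + Y x. Proof. by []. Qed.
Lemma scale_bopE a X x : (a *: X) x = a *: X x. Proof. by []. Qed.
Lemma opp_bopE X x : (- X) x = - X x. Proof. by []. Qed.
Lemma sub_bopE X Y x : (X - Y) x = X x - Y x. Proof. by []. Qed.
Lemma zero_bopE x : (0 : bop H) x = 0. Proof. by []. Qed.
Lemma op1E x : op1 H x = x. Proof. by []. Qed.

Lemma sum_bopE (I : Type) (s : seq I) (F : I -> bop H) x :
  (\sum_(i <- s) F i) x = \sum_(i <- s) F i x.
Proof. by elim/big_ind2: _ => // X a Y b <- <-. Qed.

Definition bopE := (sum_bopE, add_bopE, scale_bopE, opp_bopE, zero_bopE, op1E).

Definition bop_le X (M : R) := forall x, rnorm (X x) <= M * rnorm x.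

Lemma bop_bounded X : exists2 M, 0 < M & bop_le X M.
Proof.
have [e e0 he] : exists2 d : R, 0 < d &
    forall x, rnorm x <= d -> rnorm (X x) <= 1.
  have /cvgrPdist_le /(_ 1 ltr01) := @bop_continuous X 0.
  rewrite bop0 => /nbhs_norm0P[e /= e0 he].
  have := gtr0_real e0 => /complex_realP[d de].
  rewrite de ltr0c in e0.
  (* Half the radius, so that the closed ball lies in the open one given by continuity. *)
  exists (d / 2); first by rewrite divr_gt0.
  move=> x xd; have := he x; rewrite /= sub0r normrN rnorm_le1; apply.
  rewrite de rnormE ltcR (le_lt_trans xd)//.
  by rewrite ltr_pdivrMr// ltr_pMr// ltr1n.
exists e^-1; first by rewrite invr_gt0.
move=> x; have [->|x0] := eqVneq x 0; first by rewrite bop0 !rnorm0 mulr0.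
have px : 0 < rnorm x by rewrite rnorm_gt0.
have := he ((e / rnorm x)%:C *: x).
rewrite bopZ !rnormZ rnorm_real gtr0_norm ?divr_gt0//.
rewrite divfK ?gt_eqF// lexx => /(_ isT).
rewrite mulrAC ler_pdivrMr// mul1r => ex.
by rewrite ler_pdivlMl.
Qed.

Lemma bounded_operatorP (f : H -> H) (M : R) : linear f ->
  (forall x, rnorm (f x) <= M * rnorm x) -> f \in @bounded_operator R H.
Proof.
move=> lf fM; rewrite inE; split=> // x.
(* The sign of [M] is unknown, hence a denominator that is positive in any case. *)
have M1 : 0 < `|M| + 1 by rewrite ltr_wpDl.
apply/cvgrPdist_le => e e0; have /complex_realP[d de] := gtr0_real e0.
rewrite de ltr0c in e0 *.
have de0 : 0 < (d / (`|M| + 1))%:C by rewrite ltr0c divr_gt0.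
apply/nbhs_normP; exists (d / (`|M| + 1))%:C => //= y.
rewrite /= rnormE ltcR ltr_pdivlMr// => h.
have -> : f x - f y = f (x - y).
  by rewrite -scaleN1r addrC -lf scaleN1r addrC.
rewrite -rnorm_le (le_trans (fM _))// (le_trans _ (ltW h))// mulrC.
by rewrite ler_wpM2l ?rnorm_ge0// (le_trans (ler_norm _))// lerDl.
Qed.

Lemma bop_leW X (M N : R) : M <= N -> bop_le X M -> bop_le X N.
Proof.
by move=> MN XM x; rewrite (le_trans (XM x))// ler_wpM2r// rnorm_ge0.
Qed.

Lemma opnorm_leP X (M : R) : 0 <= M -> (opnorm X <= M%:E)%E <-> bop_le X M.
Proof.
move=> M0; split=> [h x|h].
  have [->|x0] := eqVneq x 0; first by rewrite bop0 !rnorm0 mulr0.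
  have px : 0 < rnorm x by rewrite rnorm_gt0.
  rewrite -ler_pdivrMr//.
  have : (rnorm (X ((rnorm x)^-1%:C *: x)))%:E%E \in
     [set (rnorm (X x))%:E | x in [set x : H | `|x| <= 1]].
    rewrite inE; exists ((rnorm x)^-1%:C *: x) => //=.
    by rewrite rnorm_le1 rnormZ rnorm_real gtr0_norm ?invr_gt0// mulVf ?gt_eqF.
  rewrite inE => /ereal_sup_ubound /le_trans/(_ h).
  by rewrite lee_fin bopZ rnormZ rnorm_real gtr0_norm ?invr_gt0// mulrC.
apply: ge_ereal_sup => _ [x /= + <-]; rewrite rnorm_le1 lee_fin => x1.
by rewrite (le_trans (h x))// ler_piMr.
Qed.

Lemma linear_comp_bop X Y : linear (X \o Y).
Proof. by move=> a x y /=; rewrite !bop_linear. Qed.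

Lemma comp_bop_subproof X Y : X \o Y \in @bounded_operator R H.
Proof.
rewrite inE; split; first exact: linear_comp_bop.
by move=> x; apply: continuous_comp; exact: bop_continuous.
Qed.

Definition comp_bop X Y : bop H := Bop (comp_bop_subproof X Y).

Lemma rank1_subproof u v : (fun x => inner x u *: v) \in @bounded_operator R H.
Proof.
apply: (@bounded_operatorP _ (rnorm u * rnorm v)) => [a x y|x].
  by rewrite innerDl innerZl scalerDl scalerA.
by rewrite rnormZ mulrAC ler_wpM2r ?rnorm_ge0// mulrC CauchySchwarz_rnorm.
Qed.

Definition rank1 u v : bop H := Bop (rank1_subproof u v).

Lemma rank1E u v x : rank1 u v x = inner x u *: v. Proof. by []. Qed.

(** A relation between two operators: adjoints are exhibited only for finite rank operators, by
    explicit rank one terms. *)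
Definition adjoint X Y := forall x y, inner (X x) y = inner x (Y y).

Lemma adjoint_rank1 u v : adjoint (rank1 u v) (rank1 v u).
Proof. by move=> x y; rewrite !rank1E innerZl innerZr -innerC mulrC. Qed.

Lemma adjointD X Y Z W : adjoint X Y -> adjoint Z W -> adjoint (X + Z) (Y + W).
Proof. by move=> XY ZW x y; rewrite !add_bopE innerDl innerDr XY ZW. Qed.

Lemma compact0 : compact_operator (0 : bop H).
Proof.
apply: (@precompact_subset _ _ [set 0]); last first.
  by apply: compact_precompact; [exact: norm_hausdorff|exact: compact_set1].
by move=> _ [x _ <-].
Qed.

Lemma compactD X Y :
  compact_operator X -> compact_operator Y -> compact_operator (X + Y).
Proof.
rewrite /compact_operator => cX cY; rewrite !precompactE in cX cY.
have c := compact_setX cX cY.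
apply: (@precompact_subset _ _ ((fun p : H * H => p.1 + p.2) @`
    (closure (X @` [set x : H | `|x| <= 1]) `*`
     closure (Y @` [set x : H | `|x| <= 1])))).
  move=> _ [x x1 <-]; exists (X x, Y x) => //.
  by split; apply: subset_closure; exists x.
apply: compact_precompact; first exact: norm_hausdorff.
apply: continuous_compact c; apply: continuous_subspaceT => p.
by apply: continuousD; [exact: cvg_fst|exact: cvg_snd].
Qed.

Lemma compactZ a X : compact_operator X -> compact_operator (a *: X).
Proof.
rewrite /compact_operator => cX; rewrite precompactE in cX.
apply: (@precompact_subset _ _ ((fun y : H => a *: y) @`
    closure (X @` [set x : H | `|x| <= 1]))).
  by move=> _ [x x1 <-]; exists (X x) => //; apply: subset_closure; exists x.
apply: compact_precompact; first exact: norm_hausdorff.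
apply: continuous_compact cX; apply: continuous_subspaceT => p.
exact: scaler_continuous.
Qed.

Lemma compact_sum (I : Type) (s : seq I) (F : I -> bop H) :
  (forall i, compact_operator (F i)) -> compact_operator (\sum_(i <- s) F i).
Proof.
by move=> cF; elim/big_ind: _ => //; [exact: compact0|exact: compactD].
Qed.

Lemma real_complex_continuous : continuous (fun t : R => t%:C : R[i]^o).
Proof.
move=> t; apply/cvgrPdist_le => e e0; have /complex_realP[d de] := gtr0_real e0.
rewrite de ltr0c in e0 *.
apply/nbhs_normP; exists d => //= s /= h.
by rewrite -rmorphB/= -rnorm_le rnorm_real ltW.
Qed.

Lemma compact_rank1 u v : compact_operator (rank1 u v).
Proof.
(* For [x] in the unit ball both parts of [inner x u] lie in [D], so the image of the ball lies in a
   continuous image of a compact square. *)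
pose D := `[- rnorm u, rnorm u]%classic.
have cD : compact (D `*` D) by apply: compact_setX; exact: segment_compact.
apply: (@precompact_subset _ _
    ((fun p : R * R => p.1%:C *: v + p.2%:C *: ('i *: v)) @` (D `*` D))).
  move=> _ [x x1 <-]; rewrite rank1E; move: x1 => /= x1; set z := inner x u.
  have zu : rnorm z <= rnorm u.
    rewrite (le_trans (CauchySchwarz_rnorm _ _))//.
    by rewrite ler_piMl ?rnorm_ge0 -?rnorm_le1.
  exists (complex.Re z, complex.Im z); last first.
    by rewrite /= scalerA -scalerDl mulrC -complexE.
  have := ler_normRe_rnorm z; have := ler_normIm_rnorm z.
  by rewrite /D/= !in_itv/= -!ler_norml => /le_trans-> // /le_trans->.
apply: compact_precompact; first exact: norm_hausdorff.
apply: continuous_compact cD; apply: continuous_subspaceT => p.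
have h (w : H) (g : R * R -> R) : continuous g ->
    continuous (fun p => (g p)%:C *: w).
  move=> cg q; apply: (@cvgZr_tmp _ H).
  by apply: continuous_comp; [exact: cg|exact: real_complex_continuous].
apply: (@cvgD _ H).
  by apply: (h v fst) => q; exact: cvg_fst.
by apply: (h ('i *: v) snd) => q; exact: cvg_snd.
Qed.

End Operators.

(** * Finite rank projections and cutoffs *)

Section FiniteProjections.
Variables (R : realType) (H : hilbertType R).
Implicit Types (X K P Q : bop H) (x y u v w : H) (s : seq H).

(** Finite rank orthogonal projections, given by adjoining unit vectors one at a time. As [P] is
    self-adjoint, [P w = 0] says that [w] is orthogonal to the range of [P]. *)
Inductive finproj : bop H -> Prop :=
| finproj0 : finproj 0
| finproj_add P w : finproj P -> P w = 0 -> rnorm w = 1 ->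
    finproj (P + rank1 w w).

Lemma finproj_adjoint P : finproj P -> adjoint P P.
Proof.
elim=> [x y|{}P w _ IH _ _]; first by rewrite inner0l inner0r.
by apply: adjointD => //; exact: adjoint_rank1.
Qed.

Lemma finproj_idem P x : finproj P -> P (P x) = P x.
Proof.
move=> fP; elim: fP x => [//|{}P w fP IH Pw w1] x.
rewrite !add_bopE !rank1E bopD bopZ IH Pw scaler0 addr0; congr (_ + _ *: _).
rewrite innerDl (finproj_adjoint fP) Pw inner0r add0r innerZl inner_self w1.
by rewrite expr1n mulr1.
Qed.

Lemma finproj_sqr P x : finproj P -> inner (P x) x = (rnorm (P x) ^+ 2)%:C.
Proof.
by move=> fP; rewrite -inner_self -{1}finproj_idem// finproj_adjoint.
Qed.

(** Cauchy-Schwarz for [inner (P x) x], which is the square of [rnorm (P x)]. *)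
Lemma finproj_contraction P x : finproj P -> rnorm (P x) <= rnorm x.
Proof.
move=> fP; have [->|x0] := eqVneq (P x) 0; first by rewrite rnorm0 rnorm_ge0.
have px : 0 < rnorm (P x) by rewrite rnorm_gt0.
have := CauchySchwarz_rnorm (P x) x.
by rewrite finproj_sqr// rnorm_real ger0_norm ?sqr_ge0// expr2 ler_pM2l.
Qed.

Lemma finproj_compact P : finproj P -> compact_operator P.
Proof.
elim=> [|{}P w _ IH _ _]; first exact: compact0.
by apply: compactD => //; exact: compact_rank1.
Qed.

(** Each rank one summand of [P] contributes [rank1 w (X w)], whose adjoint is explicit. *)
Lemma comp_finproj_adjoint X P : finproj P ->
  exists Y, adjoint (comp_bop X P) Y.
Proof.
elim=> [|{}P w _ [Y XY] _ _].
  by exists 0 => x y; rewrite /= bop0 inner0l inner0r.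
exists (Y + rank1 (X w) w) => x y.
rewrite -(adjointD XY (adjoint_rank1 w (X w))).
by rewrite add_bopE rank1E /= bopD bopZ.
Qed.

(** One Gram-Schmidt step, with the component of [v] orthogonal to the range of [P]. The last clause
    expresses the order [P <= Q]. *)
Lemma finproj_extend1 P v : finproj P ->
  exists Q, [/\ finproj Q, Q v = v & forall x, Q (P x) = P x].
Proof.
move=> fP; pose u := v - P v.
have Pu : P u = 0 by rewrite bopB finproj_idem// subrr.
have [u0|u0] := eqVneq u 0.
  exists P; split=> // [|x]; last exact: finproj_idem.
  by apply/esym/eqP; rewrite -subr_eq0 -/u u0.
have pu : 0 < rnorm u by rewrite rnorm_gt0.
pose w := (rnorm u)^-1%:C *: u.
have Pw : P w = 0 by rewrite bopZ Pu scaler0.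
have w1 : rnorm w = 1.
  by rewrite rnormZ rnorm_real gtr0_norm ?invr_gt0// mulVf ?gt_eqF.
exists (P + rank1 w w); split=> [||x].
- exact: finproj_add.
- rewrite add_bopE rank1E.
  have -> : inner v w = (rnorm u)%:C.
    have -> : v = u + P v by rewrite subrK.
    rewrite innerDl (finproj_adjoint fP) Pw inner0r addr0 innerZr conj_realC.
    rewrite inner_self -rmorphM; congr _%:C.
    by rewrite expr2 mulKf ?gt_eqF.
  by rewrite scalerA -rmorphM mulfV ?gt_eqF// scale1r addrC subrK.
- rewrite add_bopE rank1E finproj_idem// (finproj_adjoint fP) Pw inner0r.
  by rewrite scale0r addr0.
Qed.

Definition fixes Q s := forall v, v \in s -> Q v = v.

Lemma finproj_extend P s : finproj P ->
  exists Q, [/\ finproj Q, fixes Q s & forall x, Q (P x) = P x].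
Proof.
move=> fP; elim: s => [|v s [Q [fQ Qs QP]]].
  by exists P; split=> // x; exact: finproj_idem.
have [Q' [fQ' Q'v Q'Q]] := finproj_extend1 v fQ.
exists Q'; split=> [//|u|x]; last by rewrite -QP Q'Q.
by rewrite inE => /predU1P[->//|/Qs <-]; rewrite Q'Q.
Qed.

(** Pythagoras for [P <= Q]; along an increasing chain it makes the squared increments telescope. *)
Lemma finproj_le_diff P Q x : finproj P -> finproj Q ->
  (forall x, Q (P x) = P x) ->
  rnorm (Q x - P x) ^+ 2 = rnorm (Q x) ^+ 2 - rnorm (P x) ^+ 2.
Proof.
move=> fP fQ QP; rewrite rnormB_sqr.
have -> : inner (Q x) (P x) = (rnorm (P x) ^+ 2)%:C.
  by rewrite (finproj_adjoint fQ) QP -(finproj_adjoint fP) finproj_sqr.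
by rewrite /=; ring.
Qed.

(** The interiors of the [e]-balls around the points [f x] cover the compact closure, since a point
    of the closure is within [e / 2] of some [f x]. The net consists of points of [A], so that in
    [cutoff_step] it lies in [V]. *)
Lemma precompact_net (f : H -> H) (A : set H) (e : R) : 0 < e ->
  precompact (f @` A) ->
  exists s, (forall x, x \in s -> A x) /\
    forall x, A x -> exists2 y, y \in s & rnorm (f x - f y) <= e.
Proof.
move=> e0; rewrite precompactE compact_cover.
have e0' : 0 < e%:C :> R[i] by rewrite ltr0c.
move=> /(_ H A (fun x => (ball (f x) e%:C)^°%classic)) [].
- by move=> x _; exact: open_interior.
- move=> y /(_ (ball y (e / 2)%:C)) [].
    by apply: nbhsx_ballx; rewrite ltr0c divr_gt0.
  move=> _ [[x Ax <-] yx]; exists x => //.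
  rewrite /interior; apply/nbhs_ballP; exists (e / 2)%:C => /=.
    by rewrite ltr0c divr_gt0.
  move=> z yz.
  have -> : e = e / 2 + e / 2 by rewrite -splitr.
  by rewrite rmorphD; apply: ball_triangle yz; exact: ball_sym.
move=> D DA cov; exists (finmap.enum_fset D); split=> [x|x Ax].
  by move=> xD; have := DA x xD; rewrite inE.
have [] := cov (f x); first by apply: subset_closure; exists x.
move=> y /= yD /interior_subset; rewrite -ball_normE /= => h.
exists y => //; rewrite rnorm_distC rnorm_le; exact: ltW.
Qed.

Definition bounded_on (V : set H) X (c : R) :=
  forall x y, V x -> V y -> rnorm (inner (X x) y) <= c.

(* The point is that [P' - P] only enters through its value at [x]: pairing
   with the finite net of [V] fixed by [P'] cannot tell [P x] from [x] beyond
   that. *)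
Lemma cutoff_step (V : set H) K (a : R[i]) P (M e : R) :
  (forall x, V x -> rnorm x = 1) ->
  bounded_on V (K + a *: op1 H) 1 -> bop_le K M -> 0 <= M -> 0 < e ->
  finproj P -> (forall x, V x -> rnorm (K x - P (K x)) <= e) ->
  exists Q, [/\ finproj Q, forall x, Q (P x) = P x &
    forall x y, V x -> V y ->
      rnorm (inner ((K + a *: P) x) y) <=
        1 + 3 * e + rnorm a * rnorm (Q x - P x)].
Proof.
move=> V1 XV KM M0 e0 fP KP.
(* Chosen so that the fourth error below, at most [(M + rnorm a) * d], stays under [e]. *)
pose d := e / (M + rnorm a + 1).
have N0 : 0 < M + rnorm a + 1 by rewrite ltr_wpDl// addr_ge0 ?rnorm_ge0.
have d0 : 0 < d by rewrite divr_gt0.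
have [|s [sV sP]] := @precompact_net P V d d0.
  apply: precompact_subset (finproj_compact fP) => _ [x Vx <-].
  by exists x => //=; rewrite rnorm_le1 V1.
have [Q [fQ Qs QP]] := finproj_extend s fP.
exists Q; split=> // x y Vx Vy.
have [z zs yz] := sP _ Vy; have Vz := sV _ zs.
(* Replace [y] by the net point [z]. Since [Q z = z], the defect [x - P x] paired with [z] becomes
   [Q x - P x]; the two remaining terms are small because [P] almost fixes [K x] and because [P y]
   is close to [P z]. *)
have -> : inner ((K + a *: P) x) y =
    inner ((K + a *: op1 H) x) z - a * inner (Q x - P x) z
    + inner (K x - P (K x)) (y - z) + inner (K x + a *: x) (P y - P z).
  rewrite !bopE !innerDl !innerNl !innerBr !innerZl !(finproj_adjoint fP).
  rewrite (finproj_adjoint fQ) (Qs _ zs).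
  by ring.
have h1 := XV _ _ Vx Vz.
have h2 : rnorm (a * inner (Q x - P x) z) <= rnorm a * rnorm (Q x - P x).
  rewrite rnormM ler_wpM2l ?rnorm_ge0// (le_trans (CauchySchwarz_rnorm _ _))//.
  by rewrite (V1 z)// mulr1.
have h3 : rnorm (inner (K x - P (K x)) (y - z)) <= e * 2.
  apply: rnorm_inner_le; first exact: KP.
  by rewrite (le_trans (rnormB _ _))// !V1.
have h4 : rnorm (inner (K x + a *: x) (P y - P z)) <= e.
  apply: (@le_trans _ _ ((M + rnorm a) * d)).
    apply: rnorm_inner_le => //; rewrite (le_trans (rnormD _ _))// rnormZ.
    by have := KM x; rewrite (V1 x)// !mulr1 lerD2r.
  rewrite /d mulrA ler_pdivrMr// mulrC ler_wpM2l ?ltW//.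
  by rewrite ltrDl.
have := rnormD (inner ((K + a *: op1 H) x) z - a * inner (Q x - P x) z
    + inner (K x - P (K x)) (y - z)) (inner (K x + a *: x) (P y - P z)).
have := rnormD (inner ((K + a *: op1 H) x) z - a * inner (Q x - P x) z)
    (inner (K x - P (K x)) (y - z)).
have := rnormB (inner ((K + a *: op1 H) x) z) (a * inner (Q x - P x) z).
by lra.
Qed.

End FiniteProjections.

(** * Compact cutoffs of [K + a 1] along a chain of projections *)

Section Cutoff.
Variables (R : realType) (H : hilbertType R).
Implicit Types (X K P Q : bop H) (x y u v w : H) (s : seq H).

(** It suffices that [P] fixes a finite [e / 2]-net of the image of the unit ball: the net point
    cancels and [P] is a contraction. *)
Lemma compact_finproj_approx K (e : R) : compact_operator K -> 0 < e ->
  exists s, forall P, finproj P -> fixes P s ->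
    forall x, rnorm x <= 1 -> rnorm (K x - P (K x)) <= e.
Proof.
move=> cK e0.
have [|s [s1 sK]] := precompact_net (_ : 0 < e / 2) cK.
  by rewrite divr_gt0.
exists (map K s) => P fP Ps x; rewrite -rnorm_le1 => x1.
have [y ys Kxy] := sK _ x1.
have -> : K x - P (K x) = (K x - K y) - P (K x - K y).
  rewrite bopB (Ps (K y)) ?map_f// opprB addrCA addrC -!addrA.
  by congr (_ + _); rewrite addrCA addNr addr0.
rewrite (le_trans (rnormB _ _))// [e]splitr lerD//.
exact: le_trans (finproj_contraction _ fP) Kxy.
Qed.

Lemma cutoff_chain (V : set H) K (a : R[i]) (e : R) s :
  (forall x, V x -> rnorm x = 1) ->
  bounded_on V (K + a *: op1 H) 1 -> compact_operator K -> 0 < e ->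
  exists P : nat -> bop H, forall k, [/\ finproj (P k), fixes (P k) s,
    forall x, P k.+1 (P k x) = P k x &
    forall x y, V x -> V y -> rnorm (inner ((K + a *: P k) x) y) <=
        1 + 3 * e + rnorm a * rnorm (P k.+1 x - P k x)].
Proof.
move=> V1 XV cK e0.
have [M M0 KM] := bop_bounded K.
have [s' hs'] := compact_finproj_approx cK e0.
(* The invariant is a premise inside the existential, so that [choice] yields a total function that
   can be iterated. The vectors [s'] control [K], while [s] is prescribed by the caller. *)
have step P : exists Q, finproj P /\ fixes P (s ++ s') ->
    [/\ finproj Q /\ fixes Q (s ++ s'), forall x, Q (P x) = P x &
    forall x y, V x -> V y -> rnorm (inner ((K + a *: P) x) y) <=
        1 + 3 * e + rnorm a * rnorm (Q x - P x)].
  have [[fP Ps]|nP] := pselect (finproj P /\ fixes P (s ++ s'));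
    last by exists P.
  have [|Q [fQ QP hQ]] := cutoff_step V1 XV KM (ltW M0) e0 fP.
    move=> x Vx; apply: hs' => //; last by rewrite V1.
    by move=> v vs; apply: Ps; rewrite mem_cat vs orbT.
  exists Q => _; split=> //; split=> // v vs.
  by rewrite -(Ps v vs) QP.
have [g hg] := choice step.
have [P0 [fP0 P0s _]] := finproj_extend (s ++ s') (@finproj0 R H).
pose P k := iter k g P0.
have IP k : finproj (P k) /\ fixes (P k) (s ++ s').
  by elim: k => [//|k IH]; have [] := hg _ IH.
exists P => k; have [] := hg _ (IP k) => _ gP hP; split=> //.
  by case: (IP k).
by move=> v vs; apply: (IP k).2; rewrite mem_cat vs.
Qed.

(* Averaging along the chain beats the error of each cutoff, because the
   increments [P k.+1 x - P k x] are orthogonal. *)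
Lemma cutoff_average (V : set H) K (a : R[i]) (e : R) s :
  (forall x, V x -> rnorm x = 1) ->
  bounded_on V (K + a *: op1 H) 1 -> compact_operator K -> 0 < e ->
  exists N (P : nat -> bop H), [/\ (0 < N)%N,
    forall k, finproj (P k), forall k, fixes (P k) s &
    bounded_on V (K + a *: (N%:R^-1 *: \sum_(k < N) P k)) (1 + e)].
Proof.
move=> V1 XV cK e0.
(* The errors add up to [3 * d] from the cutoffs and twice [rnorm a * (d / 2)] from the
   increments. *)
pose d := e / (3 + rnorm a).
have N0 : 0 < 3 + rnorm a by rewrite ltr_wpDr// rnorm_ge0.
have d0 : 0 < d by rewrite divr_gt0.
have [P hP] := cutoff_chain s V1 XV cK d0.
(* More than [1 / d^2] cutoffs bring the average of a total of at most [1 / (2 d)] below [d / 2]. *)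
pose N := (Num.bound (d ^+ 2)^-1).
have dN : (d ^+ 2)^-1 < N%:R by apply: archi_boundP; rewrite invr_ge0 sqr_ge0.
have NR0 : 0 < N%:R :> R by rewrite (le_lt_trans _ dN)// invr_ge0 sqr_ge0.
have N_gt0 : (0 < N)%N by rewrite -(ltr0n R).
exists N, P; split=> // [k|k|x y Vx Vy]; try by case: (hP k).
have NC0 : N%:R != 0 :> R[i] by rewrite pnatr_eq0 -lt0n.
have -> : inner ((K + a *: (N%:R^-1 *: \sum_(k < N) P k)) x) y =
    N%:R^-1 * \sum_(k < N) inner ((K + a *: P k) x) y.
  rewrite !bopE innerDl !innerZl inner_suml.
  under [in RHS]eq_bigr do rewrite !bopE innerDl innerZl.
  rewrite big_split/= sumr_const card_ord -mulr_sumr mulrDr.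
  by rewrite -[inner (K x) y *+ N]mulr_natl mulKf// mulrCA.
rewrite rnormM rnorm_invn ler_pdivrMl//; apply: le_trans (rnorm_sum _ _) _.
have tele : \sum_(k < N) rnorm (P k.+1 x - P k x) ^+ 2 <= 1.
  have -> : \sum_(k < N) rnorm (P k.+1 x - P k x) ^+ 2 =
      \sum_(0 <= k < N) (rnorm (P k.+1 x) ^+ 2 - rnorm (P k x) ^+ 2).
    rewrite big_mkord; apply: eq_bigr => k _.
    have [fP _ PP _] := hP k; have [fP' _ _ _] := hP k.+1.
    exact: finproj_le_diff.
  rewrite telescope_sumr// lerBlDr (@le_trans _ _ 1) ?lerDl ?sqr_ge0//.
  rewrite expr_le1// ?rnorm_ge0// -(V1 _ Vx).
  by apply: finproj_contraction; case: (hP N).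
(* The inequality [t <= d / 2 + t^2 / (2 d)] trades the increments for their squares, whose sum is
   at most 1. *)
apply: (@le_trans _ _ (\sum_(k < N) (1 + 3 * d + rnorm a * (d / 2) +
     rnorm a / (2 * d) * rnorm (P k.+1 x - P k x) ^+ 2))).
  apply: ler_sum => k _; case: (hP k) => _ _ _ /(_ x y Vx Vy) /le_trans; apply.
  rewrite -!addrA !lerD2l -mulrA -mulrDr ler_wpM2l ?rnorm_ge0//.
  set t := rnorm _; rewrite -subr_ge0.
  have -> : d / 2 + (2 * d)^-1 * t ^+ 2 - t = (t - d) ^+ 2 / (2 * d).
    by field; rewrite gt_eqF.
  by rewrite divr_ge0 ?sqr_ge0// mulr_ge0// ltW.
rewrite big_split/= sumr_const card_ord -mulr_sumr -[_ *+ N]mulr_natl.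
have h : rnorm a / (2 * d) * (\sum_(k < N) rnorm (P k.+1 x - P k x) ^+ 2) <=
    N%:R * (rnorm a * (d / 2)).
  apply: (@le_trans _ _ (rnorm a / (2 * d) * 1)).
    by rewrite ler_wpM2l// divr_ge0 ?rnorm_ge0// mulr_ge0// ltW.
  rewrite mulr1 [leRHS]mulrCA ler_wpM2l ?rnorm_ge0//.
  have -> : (2 * d)^-1 = (d ^+ 2)^-1 * (d / 2) by field; rewrite gt_eqF.
  by rewrite ler_wpM2r ?ltW// divr_gt0.
have de : d * (3 + rnorm a) = e by rewrite /d divfK ?gt_eqF.
rewrite (le_trans (lerD (lexx _) h))// -mulrDr ler_wpM2l ?(ltW NR0)//.
rewrite -de; set t := rnorm a.
by rewrite le_eqVlt; apply/orP; left; apply/eqP; field.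
Qed.

End Cutoff.

(** * Normal functionals and states *)

(** The topology is initial for a map into a product, itself initial for the evaluations, so
    convergence is tested one index at a time. Used for the ultraweak topology. *)
Lemma cvg_initial_ptws (S : choiceType) (I : Type) (T : topologicalType)
    (ev : S -> {ptws I -> T}) (F : set_system S) (s : S) : Filter F ->
  (forall i, (fun x => ev x i) @ F --> ev s i) ->
  F --> (s : initial_topology ev).
Proof.
move=> FF Fs A [_ [[U oU <-] Us UA]].
have evF : ev @ F --> ev s.
  apply/cvg_sup => i B [_ [[W oW <-] Ws WB]].
  have FW : F ((fun x => ev x i) @^-1` W) by apply: Fs; exact: open_nbhs_nbhs.
  by change (F (ev @^-1` B)); apply: filterS FW => x Wx; exact: WB.
have FU : F (ev @^-1` U) by apply: evF; exact: open_nbhs_nbhs.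
by apply: filterS FU => x Ux; exact: UA.
Qed.

(** * Dominated series of complex numbers *)

Section ComplexSeries.
Variable R : realType.
Implicit Types u v : nat -> R[i]^o.

(** Real comparison test on the real and imaginary parts. *)
Lemma cvgn_complex_series u (b : nat -> R) : (forall n, rnorm (u n) <= b n) ->
  cvgn (series b) -> cvgn (series u).
Proof.
move=> ub cb.
have c (f : R[i] -> R) : (forall z, `|f z| <= rnorm z) ->
    cvgn (series (fun n => f (u n))).
  move=> hf; apply: (@normed_cvg R R^o); apply: series_le_cvg cb => n.
  - exact: normr_ge0.
  - by rewrite (le_trans (rnorm_ge0 _) (ub n)).
  - by rewrite (le_trans (hf _)).
have cRe := c (@complex.Re R).
have cIm := c (@complex.Im R).
have {}cRe : cvgn (series (fun n => complex.Re (u n))).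
  by apply: cRe => z; exact: ler_normRe_rnorm.
have {}cIm : cvgn (series (fun n => complex.Im (u n))).
  by apply: cIm => z; exact: ler_normIm_rnorm.
have -> : series u =
    (fun n => (series (fun n => complex.Re (u n)) n)%:C : R[i]^o) +
    (fun n => 'i *: ((series (fun n => complex.Im (u n)) n)%:C : R[i]^o)).
  apply/funext => n; rewrite fctE /series/= !rmorph_sum /=.
  rewrite scaler_sumr -big_split/=; apply: eq_bigr => k _.
  by rewrite [LHS]complexE.
apply: is_cvgD; last apply: is_cvgZl_tmp.
- apply/cvg_ex; exists ((limn (series (fun n => complex.Re (u n))))%:C).
  by apply: (cvg_comp _ _ cRe); exact: real_complex_continuous.
- apply/cvg_ex; exists ((limn (series (fun n => complex.Im (u n))))%:C).
  by apply: (cvg_comp _ _ cIm); exact: real_complex_continuous.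
Qed.

Lemma rnorm_limn_le u (c : R) : cvgn u -> (forall n, rnorm (u n) <= c) ->
  rnorm (limn u) <= c.
Proof.
move=> cu uc; apply/ler_addgt0Pr => e e0.
have e0' : 0 < e%:C :> R[i] by rewrite ltr0c.
have /cvgrPdist_le /(_ _ e0') [N _ /(_ N (leqnn N))] := cu.
rewrite -rnorm_le => h.
have -> : limn u = u N + (limn u - u N) by rewrite addrCA subrr addr0.
by rewrite (le_trans (rnormD _ _))// lerD.
Qed.

End ComplexSeries.

(** * Consequences of ultraweak continuity *)

Section Normal.
Variables (R : realType) (H : hilbertType R).
Implicit Types (X Y K P Q : bop H) (x y u v w : H) (s : seq H)
  (p : ultraweak_index H) (rho : predual H).

(** A summable majorant of the products of norms; times a bound of [X] it dominates the series of
    [ultraweak_eval X p]. *)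
Definition weight p (n : nat) : R :=
  rnorm ((sval p).1 n) ^+ 2 + rnorm ((sval p).2 n) ^+ 2.

Lemma weight_ge0 p n : 0 <= weight p n.
Proof. by rewrite addr_ge0 ?sqr_ge0. Qed.

Lemma cvgn_weight p : cvgn (series (weight p)).
Proof. by case: p => -[x y] /= [cx cy]; exact: is_cvg_seriesD. Qed.

Lemma rnorm_inner_weight p X (M : R) n : 0 <= M -> bop_le X M ->
  rnorm (inner (X ((sval p).1 n)) ((sval p).2 n)) <= M * weight p n.
Proof.
move=> M0 XM; rewrite /weight; set x := _.1 n; set y := _.2 n.
rewrite (le_trans (rnorm_inner_le (XM x) (lexx (rnorm y))))// -mulrA.
rewrite ler_wpM2l// -subr_ge0.
have -> : rnorm x ^+ 2 + rnorm y ^+ 2 - rnorm x * rnorm y =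
   ((rnorm x - rnorm y) ^+ 2 + rnorm x ^+ 2 + rnorm y ^+ 2) / 2 by field.
by rewrite divr_ge0// !addr_ge0// sqr_ge0.
Qed.

Lemma cvgn_weightM p (M : R) : cvgn (series (fun n => M * weight p n)).
Proof.
have -> : (fun n => M * weight p n) = M *: (weight p : nat -> R^o) by [].
exact: is_cvg_seriesZ (@cvgn_weight p).
 Qed.

Lemma cvgn_ultraweak X p : cvgn (series (fun n =>
  inner (X ((sval p).1 n)) ((sval p).2 n) : R[i]^o)).
Proof.
have [M M0 XM] := bop_bounded X.
apply: cvgn_complex_series (@cvgn_weightM p M) => n.
exact: rnorm_inner_weight (ltW M0) XM.
Qed.

Lemma ultraweak_evalB X Y p :
  ultraweak_eval (X - Y) p = ultraweak_eval X p - ultraweak_eval Y p.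
Proof.
rewrite /ultraweak_eval -lim_seriesB; try exact: cvgn_ultraweak.
by congr (limn (series _)); apply/funext => n; rewrite fctE !bopE innerBl.
Qed.

(** Past [m] the weights sum to at most [e]. The index [m] is chosen before [X], which will be the
    difference between a compression and an operator. *)
Lemma ultraweak_eval_tail p (e : R) : 0 < e -> exists m : nat,
  forall X (M : R), 0 <= M -> bop_le X M ->
    (forall n, (n < m)%N -> inner (X ((sval p).1 n)) ((sval p).2 n) = 0) ->
    rnorm (ultraweak_eval X p) <= M * e.
Proof.
move=> e0; have cw := @cvgn_weight p.
have nw : nondecreasing_seq (series (weight p)).
  by apply: nondecreasing_series => n *; exact: weight_ge0.
have /cvgrPdist_le /(_ _ e0) [m _ /(_ m (leqnn m)) hm] := cw.
exists m => X M M0 XM X0; apply: rnorm_limn_le; first exact: cvgn_ultraweak.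
move=> n; rewrite /series/=.
have -> : \sum_(0 <= k < n) inner (X ((sval p).1 k)) ((sval p).2 k) =
    \sum_(m <= k < n) inner (X ((sval p).1 k)) ((sval p).2 k).
  have [nm|mn] := leqP n m.
    rewrite [RHS]big_geq// big_nat big1// => k /andP[_ kn].
    by rewrite X0// (leq_trans kn).
  rewrite (big_cat_nat (leq0n m) (ltnW mn))/= [X in X + _](_ : _ = 0) ?add0r//.
  by rewrite big_nat big1// => k /andP[_ km]; exact: X0.
apply: le_trans (rnorm_sum _ _) _.
apply: (@le_trans _ _ (\sum_(m <= k < n) M * weight p k)).
  by apply: ler_sum => k _; exact: rnorm_inner_weight.
rewrite -mulr_sumr ler_wpM2l//.
have [nm|mn] := leqP n m; first by rewrite big_geq// ltW.
rewrite -sub_series_geq ?(ltnW mn)//.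
apply: le_trans hm; rewrite (le_trans _ (ler_norm _))// lerD2r.
exact: nondecreasing_cvgn_le.
Qed.

Lemma ultraweak_eval_bounded p : exists2 c : R, 0 <= c &
  forall X (M : R), 0 <= M -> bop_le X M -> rnorm (ultraweak_eval X p) <= M * c.
Proof.
have cw := @cvgn_weight p.
have nw : nondecreasing_seq (series (weight p)).
  by apply: nondecreasing_series => n *; exact: weight_ge0.
have nl n : series (weight p) n <= limn (series (weight p)).
  exact: nondecreasing_cvgn_le.
exists (limn (series (weight p))).
  by apply: le_trans (nl 0%N); rewrite /series/= big_geq.
move=> X M M0 XM; apply: rnorm_limn_le; first exact: cvgn_ultraweak.
move=> n; apply: le_trans (rnorm_sum _ _) _.
apply: le_trans (ler_wpM2l M0 (nl n)); rewrite /series/= mulr_sumr.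
by apply: ler_sum => k _; exact: rnorm_inner_weight.
Qed.

Lemma predual_linear rho : linear rho.
Proof. by case: rho => f /= /set_mem[]. Qed.

Lemma predual_continuous rho : continuous (rho : ultraweak H -> R[i]^o).
Proof. by case: rho => f /= /set_mem[]. Qed.

Lemma predualD rho X Y : rho (X + Y) = rho X + rho Y.
Proof. by rewrite -[X]scale1r predual_linear !scale1r. Qed.

Lemma predual0 rho : rho 0 = 0.
Proof. by apply: (addrI (rho 0)); rewrite -predualD !addr0. Qed.

Lemma predualZ rho a X : rho (a *: X) = a * rho X.
Proof. by rewrite -[a *: X]addr0 predual_linear predual0 addr0. Qed.

Lemma predualB rho X Y : rho (X - Y) = rho X - rho Y.
Proof. by rewrite -scaleN1r predualD predualZ mulN1r. Qed.

Lemma predual_sum rho (I : Type) (r : seq I) (F : I -> bop H) :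
  rho (\sum_(i <- r) F i) = \sum_(i <- r) rho (F i).
Proof.
by elim/big_ind2: _ => [|X a Y b <- <-|//]; rewrite ?predual0 ?predualD.
Qed.

(** The norm neighbourhoods of 0 form a filter that converges ultraweakly to 0, so [rho] is at most
    1 in modulus on a small norm ball; then rescale. *)
Lemma predual_bounded rho : exists2 c : R, 0 <= c &
  forall X (M : R), 0 <= M -> bop_le X M -> rnorm (rho X) <= c * M.
Proof.
pose F : set_system (bop H) :=
  [set A | exists2 e : R, 0 < e & forall X, bop_le X e -> A X].
have FF : Filter F.
  split=> [|A B [d d0 hA] [e e0 hB]|A B AB [d d0 hA]].
  - by exists 1.
  - exists (Num.min d e); first by rewrite lt_min d0.
    by move=> X hX; split; [apply: hA|apply: hB]; apply: bop_leW hX;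
      rewrite ge_min lexx ?orbT.
  - by exists d => // X /hA /AB.
have F0 : F --> (0 : ultraweak H).
  apply: cvg_initial_ptws => p; apply/cvgrPdist_le => e e0.
  have /complex_realP[d de] := gtr0_real e0.
  rewrite de ltr0c in e0 *.
  have [c c0 hc] := ultraweak_eval_bounded p.
  have c1 : 0 < c + 1 by rewrite ltr_wpDl.
  exists (d / (c + 1)); first by rewrite divr_gt0.
  move=> X hX; rewrite -ultraweak_evalB -rnorm_le sub0r.
  apply: (@le_trans _ _ (d / (c + 1) * c)).
    apply: hc; first by rewrite divr_ge0// ltW.
    by move=> x; rewrite opp_bopE rnormN.
  by rewrite mulrAC ler_pdivrMr// ler_wpM2l ?ltW// ltrDl.
have /cvgrPdist_le : rho @ F --> rho 0.
  exact: (cvg_comp _ _ F0 (@predual_continuous rho 0)).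
move=> /(_ 1 ltr01) [e e0 he].
exists e^-1; first by rewrite invr_ge0 ltW.
(* The rescaling by [e / M] requires [M] to be nonzero. *)
move=> X M M0 XM; have [M00|Mn0] := eqVneq M 0.
  have -> : X = 0.
    apply: bop_ext => x; apply/eqP; rewrite -rnorm_eq0 eq_le rnorm_ge0 andbT.
    by rewrite (le_trans (XM x))// M00 mul0r.
  by rewrite predual0 rnorm0 M00 mulr0.
have Mp : 0 < M by rewrite lt_neqAle eq_sym Mn0.
have := he ((e / M)%:C *: X).
rewrite predual0 sub0r normrN predualZ rnorm_le1 rnormM rnorm_real.
rewrite gtr0_norm ?divr_gt0// mulrAC ler_pdivrMr// mul1r => h.
rewrite ler_pdivlMl//; apply: h => x.
rewrite scale_bopE rnormZ rnorm_real gtr0_norm ?divr_gt0// mulrAC.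
by rewrite ler_pdivrMr// -mulrA ler_wpM2l ?(ltW e0)// mulrC; exact: XM.
Qed.

Definition compress P X := comp_bop P (comp_bop X P).

Lemma compress_le P X (M : R) : 0 <= M -> finproj P -> bop_le X M ->
  bop_le (compress P X) M.
Proof.
move=> M0 fP XM x; apply: le_trans (finproj_contraction _ fP) _.
by apply: le_trans (XM _) _; rewrite ler_wpM2l// finproj_contraction.
Qed.

(** Filtered by the finite sets that [P] must fix, the compressions [P X P] converge ultraweakly to
    [X]: if [P] fixes the first [m] entries of both sequences, the first [m] terms agree and the
    tail is uniformly small. *)
Lemma predual_compress rho X (e : R) : 0 < e ->
  exists s, forall P, finproj P -> fixes P s ->
    rnorm (rho (compress P X) - rho X) <= e.
Proof.
move=> e0.
pose F : set_system (bop H) :=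
  [set A | exists s, forall P, finproj P -> fixes P s -> A (compress P X)].
have FF : Filter F.
  split=> [|A B [s hA] [t hB]|A B AB [s hA]].
  - by exists [::].
  - exists (s ++ t) => P fP Pst; split; [apply: hA|apply: hB] => // v vs;
    by apply: Pst; rewrite mem_cat vs ?orbT.
  - by exists s => P fP Ps; exact/AB/hA.
have FX : F --> (X : ultraweak H).
  apply: cvg_initial_ptws => p; apply/cvgrPdist_le => d' d0.
  have /complex_realP[d de] := gtr0_real d0.
  rewrite de ltr0c in d0 *.
  have [M M0 XM] := bop_bounded X.
  have [|m hm] := @ultraweak_eval_tail p (d / (M + M)).
    by rewrite divr_gt0// addr_gt0.
  exists (map (sval p).1 (iota 0 m) ++ map (sval p).2 (iota 0 m)) => P fP Ps.
  rewrite -ultraweak_evalB -rnorm_le.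
  have -> : d = (M + M) * (d / (M + M)).
    by rewrite mulrC divfK// gt_eqF ?addr_gt0.
  apply: hm => [|x|n nm].
  - by rewrite addr_ge0 ?ltW.
  - rewrite sub_bopE (le_trans (rnormB _ _))// mulrDl lerD//.
    exact: (compress_le (ltW M0) fP XM).
  - rewrite sub_bopE innerBl /= (finproj_adjoint fP).
    have nI : n \in iota 0 m by rewrite mem_iota.
    rewrite (Ps ((sval p).2 n)) ?(Ps ((sval p).1 n)) ?subrr//.
      by rewrite mem_cat map_f.
    by rewrite mem_cat orbC map_f.
have /cvgrPdist_le : rho @ F --> rho X.
  exact: (cvg_comp _ _ FX (@predual_continuous rho X)).
have e0' : 0 < e%:C :> R[i] by rewrite ltr0c.
move=> /(_ _ e0') [s hs]; exists s => P fP Ps.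
by rewrite rnorm_distC rnorm_le; exact: hs.
Qed.

End Normal.

Lemma ptws_eval_continuous (I : Type) (T : topologicalType) (i : I) :
  continuous (fun f : {ptws I -> T} => f i).
Proof.
move=> f; have /cvg_sup/(_ i) h : f --> f by exact: cvg_id.
move=> A; rewrite nbhsE => -[U [oU Uf] UA]; apply: h.
exists ((fun g : {ptws I -> T} => g i) @^-1` U).
by split; [exists U| |move=> g /UA].
Qed.

(** * Vector states, and the operator norm as a bound for normal states *)

Section States.
Variables (R : realType) (H : hilbertType R).
Implicit Types (X Y Z K P Q : bop H) (x y u v w : H) (s : seq H)
  (rho : predual H).

Lemma comp_finproj_compact X P : finproj P -> compact_operator (comp_bop X P).
Proof.
elim=> [|{}P w _ IH _ _].
  have -> : comp_bop X 0 = 0 by apply: bop_ext => x; rewrite /= bop0.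
  exact: compact0.
have -> : comp_bop X (P + rank1 w w) = comp_bop X P + rank1 w (X w).
  by apply: bop_ext => x; rewrite add_bopE rank1E /= bopD bopZ.
by apply: compactD => //; exact: compact_rank1.
Qed.

Lemma compress_compact P X : finproj P -> compact_operator (compress P X).
Proof. exact: (@comp_finproj_compact (comp_bop P X)). Qed.

Lemma compress_adjoint P X : finproj P -> exists Y, adjoint (compress P X) Y.
Proof.
move=> fP; have [Y XY] := comp_finproj_adjoint X fP.
by exists (comp_bop Y P) => x y; rewrite /= -XY /= (finproj_adjoint fP).
Qed.

(** Supported at index 0, it makes a vector functional an instance of [ultraweak_eval]. *)
Definition delta0 u (n : nat) : H := if n is 0 then u else 0.

Lemma cvg_series_delta0 (K : numFieldType) (f : nat -> K) :
  (forall n, f n.+1 = 0) -> series f @ \oo --> f 0%N.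
Proof.
move=> f0; rewrite -(cvg_shiftn 1) (_ : (fun n => _) = cst (f 0%N)).
  exact: cvg_cst.
apply/funext => n; rewrite /series/= addn1 big_nat_recl// big1 ?addr0//.
Qed.

Lemma square_summable_delta0 u : square_summable (delta0 u).
Proof.
apply/cvg_ex; exists (rnorm (delta0 u 0) ^+ 2).
apply: (@cvg_series_delta0 R (fun n => rnorm (delta0 u n) ^+ 2)) => n.
by rewrite /= rnorm0 expr0n.
Qed.

Lemma vector_functional_subproof u :
  (fun X : bop H => inner (X u) u : R[i]^o) \in @normal_functional R H.
Proof.
apply/mem_set; split=> [a X Y|].
  by rewrite !bopE innerDl innerZl.
pose p : ultraweak_index H := exist _ (delta0 u, delta0 u)
  (conj (@square_summable_delta0 u) (@square_summable_delta0 u)).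
have -> : (fun X : bop H => inner (X u) u : R[i]^o) =
    (fun X => ultraweak_eval X p).
  apply/funext => X; apply/esym/cvg_lim => //.
  apply: (@cvg_series_delta0 R[i]
    (fun n => inner (X (delta0 u n)) (delta0 u n))).
  by move=> n; rewrite inner0r.
move=> X; apply: (@continuous_comp _ _ _
  (@ultraweak_eval R H : ultraweak H -> _) (fun f => f p)).
  exact: initial_continuous.
exact: ptws_eval_continuous.
Qed.

Definition vector_functional u : predual H :=
  Predual (vector_functional_subproof u).

Lemma vector_functionalE u X : vector_functional u X = inner (X u) u.
Proof. by []. Qed.

Lemma vector_state u : rnorm u = 1 -> normal_state (vector_functional u).
Proof.
move=> u1; split=> [X|]; first by rewrite vector_functionalE; exact.
by rewrite vector_functionalE op1E inner_self u1 expr1n.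
Qed.

(** An inequality in [R[i]] includes equality of the imaginary parts, so the sums are real; the
    phases 1 and [i] then determine [z2]. *)
Lemma conj_of_phases (z1 z2 : R[i]) (c : R) :
  (forall a, rnorm a = 1 -> a * z1 + Num.conj a * z2 <= c%:C) ->
  z2 = Num.conj z1.
Proof.
have ImD (x y : R[i]) : complex.Im (x + y) = complex.Im x + complex.Im y.
  by case: x; case: y.
move=> h.
have /h : rnorm (1 : R[i]) = 1 by rewrite /rnorm normr1.
rewrite lecE rmorph1 !mul1r ImD => /andP[/eqP/= h1 _].
have := h _ (rnormi R); rewrite {2}complexiE conjCi -complexiE lecE.
rewrite mulNr ![ 'i%C * _]mulrC -mulNr ImD !ImiRe => /andP[/eqP/= h2 _].
case: z1 z2 h1 h2 {h} => a b [c' d] /= h1 h2; apply/eqP; rewrite eq_complex /=.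
by apply/andP; split; apply/eqP; lra.
Qed.

(* Positivity of [2 M - (a Y + conj a Z)] for all phases [a] forces
   [rho Z = conj (rho Y)] and then [Re (a rho Y) <= M]. *)
Lemma state_le_adjoint rho Y Z (M : R) : normal_state rho ->
  adjoint Y Z -> bop_le Y M -> rnorm (rho Y) <= M.
Proof.
move=> [rho0 rho1] YZ YM.
have key (a : R[i]) : rnorm a = 1 ->
    a * rho Y + Num.conj a * rho Z <= (2 * M)%:C.
  move=> a1; rewrite -subr_ge0.
  have -> : (2 * M)%:C - (a * rho Y + Num.conj a * rho Z) =
      rho ((2 * M)%:C *: op1 H - (a *: Y + Num.conj a *: Z)).
    by rewrite predualB !predualD !predualZ rho1 mulr1.
  apply: rho0 => x; rewrite !bopE innerDl innerNl innerDl !innerZl inner_self.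
  have -> : inner (Z x) x = Num.conj (inner (Y x) x) by rewrite innerC YZ.
  set z := inner (Y x) x.
  have -> : (a * z + Num.conj a * Num.conj z) = (2 * complex.Re (a * z))%:C.
    rewrite rmorphM rmorph_nat -addcJ; congr (_ + _).
    by rewrite -rmorphM.
  rewrite -rmorphM -rmorphB -[0]/(0%:C) lecR subr_ge0 -mulrA ler_wpM2l//.
  rewrite (le_trans (ler_Re_rnorm _))// rnormM a1 mul1r expr2 mulrA.
  exact: rnorm_inner_le.
have e : rho Z = Num.conj (rho Y).
  exact: conj_of_phases key.
have [a a1 ha] := rnorm_phase (rho Y).
have ra : rnorm a = 1 by rewrite /rnorm a1.
have := key a ra; rewrite e.
have -> : Num.conj a * Num.conj (rho Y) = (rnorm (rho Y))%:C.
  by rewrite -conj_realC -ha [RHS]rmorphM.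
rewrite ha -rmorphD lecR.
by lra.
Qed.

(** Compressions have adjoints and obey the same bound as [X]; their values under [rho] approximate
    [rho X]. *)
Lemma state_le rho X (M : R) : normal_state rho -> 0 <= M -> bop_le X M ->
  rnorm (rho X) <= M.
Proof.
move=> srho M0 XM; apply/ler_addgt0Pr => e e0.
have [s hs] := predual_compress rho X e0.
have [P [fP Ps _]] := finproj_extend s (@finproj0 R H).
have [Z adjZ] := compress_adjoint X fP.
have h := state_le_adjoint srho adjZ (compress_le M0 fP XM).
have -> : rho X = rho (compress P X) - (rho (compress P X) - rho X).
  by rewrite subKr.
by rewrite (le_trans (rnormB _ _))// lerD// hs.
Qed.

Lemma finproj_compress_op1 P : finproj P -> compress P (op1 H) = P.
Proof. by move=> fP; apply: bop_ext => x /=; rewrite finproj_idem. Qed.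

(** Each [P k] is a compression of 1, so [rho (P k)] is close to [rho 1] once [P k] fixes [s].
    Averaging keeps this, and the denominator [rnorm a + 1] absorbs the coefficient [a]. *)
Lemma cutoff_predual (V : set H) K (a : R[i]) rho (e : R) :
  (forall x, V x -> rnorm x = 1) ->
  bounded_on V (K + a *: op1 H) 1 -> compact_operator K -> 0 < e ->
  exists Y, [/\ compact_operator Y, bounded_on V Y (1 + e) &
    rnorm (rho Y - rho (K + a *: op1 H)) <= e].
Proof.
move=> V1 XV cK e0.
have a1 : 0 < rnorm a + 1 by rewrite ltr_wpDl// rnorm_ge0.
have [|s hs] := @predual_compress _ _ rho (op1 H) (e / (rnorm a + 1)).
  by rewrite divr_gt0.
have [N [P [N0 fP Ps PV]]] := cutoff_average s V1 XV cK e0.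
have NC0 : N%:R != 0 :> R[i] by rewrite pnatr_eq0 -lt0n.
exists (K + a *: (N%:R^-1 *: \sum_(k < N) P k)); split=> //.
  apply: compactD => //; do 2!apply: compactZ; apply: compact_sum => k.
  exact: finproj_compact.
have -> : rho (K + a *: (N%:R^-1 *: \sum_(k < N) P k)) - rho (K + a *: op1 H) =
    a * (N%:R^-1 * \sum_(k < N) (rho (P k) - rho (op1 H))).
  rewrite !predualD !predualZ predual_sum sumrB sumr_const card_ord.
  rewrite opprD addrACA subrr add0r [in RHS]mulrBr.
  by rewrite -[rho (op1 H) *+ N]mulr_natl mulKf// mulrBr.
rewrite !rnormM rnorm_invn.
apply: (@le_trans _ _ (rnorm a * (e / (rnorm a + 1)))).
  rewrite ler_wpM2l ?rnorm_ge0// ler_pdivrMl ?ltr0n//.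
  apply: le_trans (rnorm_sum _ _) _.
  apply: (@le_trans _ _ (\sum_(k < N) (e / (rnorm a + 1)))).
    apply: ler_sum => k _.
    by have := hs (P k) (fP k) (Ps k); rewrite finproj_compress_op1.
  by rewrite sumr_const card_ord -[_ *+ N]mulr_natl.
rewrite mulrA ler_pdivrMr// mulrC ler_wpM2l ?(ltW e0)//.
by rewrite lerDl.
Qed.

End States.

(** * The closed convex hull *)

Section Hull.
Variables (R : realType) (H : hilbertType R).
Implicit Types (X Y : bop H) (x y u v w c : H) (V S : set H).
Local Open Scope convex_scope.

Lemma closure_approx S x (e : R) : 0 < e -> closure S x ->
  exists2 y, S y & rnorm (x - y) < e.
Proof.
move=> e0 /(_ (ball x e%:C)) [].
  by apply: nbhsx_ballx; rewrite ltr0c.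
move=> y [Sy]; rewrite -ball_normE /= rnormE ltcR => xy.
by exists y.
Qed.

Lemma not_closure_gap S x : ~ closure S x ->
  exists2 e : R, 0 < e & forall y, S y -> e <= rnorm (x - y).
Proof.
move=> nSx; apply: contrapT => h; apply: nSx => B /nbhs_ballP[e' /= e0' eB].
have /complex_realP[e de] := gtr0_real e0'.
rewrite de ltr0c in e0' eB.
have [y Sy xy] : exists2 y, S y & rnorm (x - y) < e.
  apply: contrapT => k; apply: h; exists e => // y Sy.
  by rewrite leNgt; apply/negP => xy; apply: k; exists y.
exists y; split=> //; apply: eB.
by rewrite -ball_normE /= rnormE ltcR.
Qed.

Definition hull V := smallest (@convex_set R[i] H) V.

Lemma hull_convex V x y (t : R) : 0 <= t -> t <= 1 -> hull V x -> hull V y ->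
  hull V (t%:C *: x + (1 - t)%:C *: y).
Proof.
move=> t0 t1 hx hy A [cA VA].
have t0' : 0 <= t%:C :> R[i] by rewrite -[0]/(0%:C) lecR.
have t1' : t%:C <= 1 :> R[i] by rewrite -[1]/(1%:C) lecR.
have := cA x y (Itv01 t0' t1').
rewrite !inE => /(_ (hx _ (conj cA VA)) (hy _ (conj cA VA))).
by rewrite rmorphB.
Qed.

(** Convexity over [R[i]] takes its parameters there; the order forces them to be real. *)
Lemma i01_real (l : {i01 R[i]}) :
  exists t : R, [/\ 0 <= t, t <= 1 & l%:num = t%:C].
Proof.
have l0 : 0 <= l%:num by [].
have l1 : l%:num <= 1 by [].
have /complex_realP[t e] := ger0_real l0.
by exists t; move: l0 l1; rewrite e -[0]/(0%:C) -[1]/(1%:C) !lecR.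
Qed.

Lemma closed_convex_hull_le V (g : H -> R) (M c : R) x : 0 <= M ->
  (forall y z (t : R), 0 <= t -> t <= 1 ->
     g (t%:C *: y + (1 - t)%:C *: z) <= t * g y + (1 - t) * g z) ->
  (forall y z, g y <= g z + M * rnorm (y - z)) ->
  (forall v, V v -> g v <= c) ->
  closed_convex_hull V x -> g x <= c.
Proof.
move=> M0 gc gM gV hx.
have hV y : hull V y -> g y <= c.
  move=> hy; apply: (hy [set y | g y <= c]); split=> // {hy}y z l.
  rewrite !inE /= => gy gz.
  have [t [t0 t1 lt]] := i01_real l.
  have -> : (y : convex_lmodType H) <| l |> z =
      t%:C *: (y : H) + (1 - t)%:C *: (z : H).
    have -> : (1 - t)%:C = 1 - l%:num :> R[i] by rewrite lt rmorphB.
    by rewrite -lt.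
  apply: le_trans (gc _ _ _ t0 t1) _.
  have -> : c = t * c + (1 - t) * c by ring.
  by rewrite lerD// ler_wpM2l// subr_ge0.
apply/ler_addgt0Pr => e e0.
have M1 : 0 < M + 1 by rewrite ltr_wpDl.
have [|y hy xy] := closure_approx (_ : 0 < e / (M + 1)) hx.
  by rewrite divr_gt0.
apply: le_trans (gM x y) _; rewrite lerD ?hV//.
apply: (@le_trans _ _ (M * (e / (M + 1)))); first by rewrite ler_wpM2l// ltW.
by rewrite mulrA ler_pdivrMr// mulrC ler_wpM2l ?(ltW e0)// lerDl.
Qed.

Lemma inner_convex_combination (f : H -> R[i]) :
  linear (f : H -> R[i]^o) -> forall y z (t : R), 0 <= t -> t <= 1 ->
  rnorm (f (t%:C *: y + (1 - t)%:C *: z)) <=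
     t * rnorm (f y) + (1 - t) * rnorm (f z).
Proof.
move=> lf y z t t0 t1.
have f0 : f 0 = 0.
  by apply: (addrI (f 0)); have := lf 1 0 0; rewrite !scale1r !addr0 => <-.
have fZ a v : f (a *: v) = a * f v.
  by have := lf a v 0; rewrite addr0 f0 addr0.
rewrite lf fZ (le_trans (rnormD _ _))// !rnormM !rnorm_real.
by rewrite !ger0_norm ?subr_ge0.
Qed.

Lemma rnorm_closed_convex_hull V x : (forall v, V v -> rnorm v = 1) ->
  closed_convex_hull V x -> rnorm x <= 1.
Proof.
move=> V1; apply: (@closed_convex_hull_le V (fun y => rnorm y) 1) => //.
- move=> y z t t0 t1; rewrite (le_trans (rnormD _ _))// !rnormZ !rnorm_real.
  by rewrite !ger0_norm ?subr_ge0.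
- move=> y z; rewrite mul1r.
  by rewrite -{1}[y](subrK z) addrC (le_trans (rnormD _ _)).
- by move=> v Vv; rewrite V1.
Qed.

(** The modulus of the pairing is convex and Lipschitz in each variable, so the hull is reached
    first in [x], then in [y]. *)
Lemma bounded_on_hull V X : bounded_on V X 1 ->
  bounded_on (closed_convex_hull V) X 1.
Proof.
move=> XV; have [M M0 XM] := bop_bounded X.
have h1 x y : closed_convex_hull V x -> V y -> rnorm (inner (X x) y) <= 1.
  move=> hx Vy; move: hx.
  apply: (@closed_convex_hull_le V (fun x => rnorm (inner (X x) y))
    (M * rnorm y)).
  - by rewrite mulr_ge0 ?(ltW M0) ?rnorm_ge0.
  - apply: (@inner_convex_combination (fun x => inner (X x) y)) => a u v.
    by rewrite bop_linear innerDl innerZl.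
  - move=> u v; rewrite -{1}[u](subrK v) addrC bopD innerDl.
    rewrite (le_trans (rnormD _ _))// lerD2l mulrAC.
    exact: rnorm_inner_le.
  - by move=> u Vu; exact: XV.
move=> x y hx.
apply: (@closed_convex_hull_le V (fun y => rnorm (inner (X x) y))
  (rnorm (X x))).
- exact: rnorm_ge0.
- move=> u v t t0 t1.
  (* The second argument is conjugate linear; swapping keeps the modulus and restores linearity. *)
  have e z : rnorm (inner (X x) z) = rnorm (inner z (X x)).
    by rewrite innerC rnorm_conj.
  rewrite !e.
  apply: (@inner_convex_combination (fun z => inner z (X x))) => // a w w'.
  by rewrite innerDl innerZl.
- move=> u v; rewrite -{1}[u](subrK v) addrC innerDr.
  rewrite (le_trans (rnormD _ _))// lerD2l.
  exact: CauchySchwarz_rnorm.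
- by move=> v Vv; exact: h1.
Qed.

(* An almost nearest point of the hull serves instead of the projection. *)
Lemma separation V x : (forall v, V v -> rnorm v = 1) -> V !=set0 ->
  ~ closed_convex_hull V x ->
  exists2 w, w != 0 &
    forall v, V v -> complex.Re (inner v w) <= complex.Re (inner x w).
Proof.
move=> V1 [v0 Vv0] /not_closure_gap[d d0 hd].
have sV y : V y -> hull V y by exact: sub_gen_smallest.
have hull1 y : hull V y -> rnorm y <= 1.
  move=> hy; apply: (@rnorm_closed_convex_hull V) => //.
  exact: subset_closure.
pose D := [set rnorm (x - y) ^+ 2 | y in hull V].
have D_inf : has_inf D.
  split; first by exists (rnorm (x - v0) ^+ 2); exists v0 => //; exact: sV.
  by exists 0 => _ [y _ <-]; exact: sqr_ge0.
pose m := inf D.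
have mD y : hull V y -> m <= rnorm (x - y) ^+ 2.
  by move=> hy; apply: ge_inf; [exact: D_inf.2|exists y].
have m0 : 0 < m.
  apply: (@lt_le_trans _ _ (d ^+ 2)); first by rewrite exprn_gt0.
  apply: lb_le_inf; first exact: D_inf.1.
  by move=> _ [y hy <-]; rewrite lerXn2r ?nnegrE ?rnorm_ge0 ?(ltW d0)// hd.
(* Moving [p] towards [v] by [t] changes the squared distance by [-2 t Re <v - p, w>] plus at most
   [4 t^2 <= t m / 2]. With [p] optimal up to [t m / 2], this gives [Re <v - p, w> <= m / 2], below
   [|w|^2]. *)
pose t := Num.min 1 (m / 8).
have t0 : 0 < t by rewrite lt_min ltr01 divr_gt0.
have t1 : t <= 1 by rewrite ge_min lexx.
have t8 : t <= m / 8 by rewrite ge_min lexx orbT.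
have tm : 0 < t * m / 2 by rewrite divr_gt0// mulr_gt0.
have [_ [p hp <-] pm] := inf_adherent tm D_inf.
exists (x - p).
  by rewrite -rnorm_gt0 (lt_le_trans d0)// hd.
move=> v Vv; set w := x - p.
have hq := mD _ (hull_convex (ltW t0) t1 (sV _ Vv) hp).
have eq : x - (t%:C *: v + (1 - t)%:C *: p) = w - t%:C *: (v - p).
  rewrite rmorphB rmorph1 scalerBl scale1r scalerBr /w opprD !opprB -addrA.
  by congr (_ + _); rewrite addrCA [RHS]addrCA [_ - p]addrC.
have vp : rnorm (t%:C *: (v - p)) ^+ 2 <= t ^+ 2 * 4.
  rewrite rnormZ rnorm_real gtr0_norm// exprMn ler_wpM2l ?sqr_ge0//.
  have h : rnorm (v - p) <= 2.
    by have := rnormB v (p : H); have := hull1 _ hp; rewrite (V1 _ Vv); lra.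
  by have := rnorm_ge0 (v - p); nra.
have ww : complex.Re (inner w w) = rnorm w ^+ 2 by rewrite inner_self.
have e1 : complex.Re (inner w (t%:C *: (v - p))) =
    t * (complex.Re (inner v w) - complex.Re (inner p w)).
  rewrite innerZr conj_realC innerC innerBl.
  by case: (inner v w) (inner p w) => a b [a' b'] /=; ring.
have e2 : complex.Re (inner p w) = complex.Re (inner x w) - rnorm w ^+ 2.
  rewrite -ww -raddfB -innerBl.
  by congr (complex.Re (inner _ _)); rewrite /w opprB addrCA subrr addr0.
have wm : m <= rnorm w ^+ 2 by exact: mD.
rewrite eq rnormB_sqr e1 in hq.
rewrite -/w in pm.
set A := complex.Re (inner v w) in e1 hq *.
set B := complex.Re (inner p w) in e1 e2 hq *.
set C := complex.Re (inner x w) in e2 *.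
have : t * (A - B) <= t * (m / 2).
  have : t ^+ 2 * 4 <= t * (m / 2).
    by rewrite expr2 -mulrA ler_wpM2l ?(ltW t0)//; lra.
  by rewrite -mulrA in pm; lra.
rewrite ler_pM2l//; lra.
Qed.

End Hull.

(** * The inner radius and the entanglement measure *)

Section Radius.
Variables (R : realType) (H : hilbertType R) (V : set H).
Hypothesis V1 : forall v, V v -> rnorm v = 1.
Hypothesis phaseV : forall (a : R[i]) (x : H), `|a| = 1 -> V x -> V (a *: x).
Hypothesis V0 : V !=set0.
Local Notation r := (inner_radius V).
Implicit Types (X Y K : bop H) (x y u v w : H) (rho : predual H).

Let A := [set t : R | 0 <= t /\
   [set x : H | rnorm x <= t] `<=` closed_convex_hull V].

Let A_ub : ubound A 1.
Proof.
move=> t [t0 tV]; have [v Vv] := V0.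
have := rnorm_closed_convex_hull V1 (tV (t%:C *: v) _).
rewrite rnormZ rnorm_real (V1 Vv) ger0_norm// mulr1; apply.
by rewrite /= rnormZ rnorm_real (V1 Vv) ger0_norm// mulr1.
Qed.

Lemma inner_radius_ge0 : 0 <= r.
Proof.
have [A0|/set0P/negP/negPn/eqP A0] := pselect (A !=set0).
  have [t At] := A0; apply: le_trans (ub_le_sup _ At); first by case: At.
  by exists 1; exact: A_ub.
(* The supremum of the empty set is 0 by convention. *)
by rewrite /inner_radius -/A A0 sup0.
Qed.

Lemma ball_sub_hull (t : R) x : t < r -> rnorm x <= t -> closed_convex_hull V x.
Proof.
move=> tr xt.
have A0 : A !=set0.
  apply/set0P/negP => /eqP A0; move: tr; rewrite /inner_radius -/A A0 sup0.
  by move/(le_lt_trans xt); rewrite ltNge rnorm_ge0.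
have [s [s0 sV] ts] := sup_gt A0 tr.
by apply: sV; rewrite /= (le_trans xt (ltW ts)).
Qed.

Lemma ball_not_sub_hull (s : R) : r < s ->
  exists2 x, rnorm x <= s & ~ closed_convex_hull V x.
Proof.
move=> rs; apply: contrapT => h.
have As : A s.
  split; first exact: le_trans inner_radius_ge0 (ltW rs).
  by move=> x xs; apply: contrapT => nx; apply: h; exists x.
have : s <= r by apply: ub_le_sup As; exists 1; exact: A_ub.
by rewrite leNgt rs.
Qed.

(** Test [X] on the multiples of [x] and [X x] of norm [t < r], which lie in the hull, and let [t]
    approach [r]. *)
Lemma bounded_on_bop_le X : 0 < r -> bounded_on V X 1 -> bop_le X (1 / r ^+ 2).
Proof.
move=> r0 /bounded_on_hull XV x.
have [Xx0|Xx0] := eqVneq (X x) 0.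
  by rewrite Xx0 rnorm0 mulr_ge0 ?rnorm_ge0// divr_ge0// sqr_ge0.
have x0 : x != 0 by apply: contra_neq Xx0 => ->; exact: bop0.
have px : 0 < rnorm x by rewrite rnorm_gt0.
have pX : 0 < rnorm (X x) by rewrite rnorm_gt0.
have key (t : R) : 0 <= t -> t < r -> t ^+ 2 * rnorm (X x) <= rnorm x.
  move=> t0 tr.
  have h (y : H) : 0 < rnorm y -> closed_convex_hull V ((t / rnorm y)%:C *: y).
    move=> y0; apply: (ball_sub_hull tr).
    rewrite rnormZ rnorm_real (ger0_norm (divr_ge0 t0 (ltW y0))).
    by rewrite divfK// gt_eqF.
  have := XV _ _ (h _ px) (h _ pX).
  rewrite bopZ innerZl innerZr conj_realC inner_self -!rmorphM rnorm_real.
  move=> /(le_trans (ler_norm _)).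
  have -> : t / rnorm x * (t / rnorm (X x) * rnorm (X x) ^+ 2) =
      t ^+ 2 * rnorm (X x) / rnorm x by field; rewrite !gt_eqF.
  by rewrite ler_pdivrMr// mul1r.
rewrite leNgt mul1r; apply/negP => lt.
have {lt} lt : rnorm x / rnorm (X x) < r ^+ 2.
  by rewrite ltr_pdivrMr// -ltr_pdivrMl// exprn_gt0.
(* If the bound failed, the midpoint of [q] and [r] would be a [t < r] that contradicts [key]. *)
set q := Num.sqrt (rnorm x / rnorm (X x)).
have q0 : 0 <= q by exact: sqrtr_ge0.
have qr : q < r.
  rewrite -(ltr_pXn2r (_ : 0 < 2)%N)// ?nnegrE ?(ltW r0)//.
  by rewrite sqr_sqrtr// divr_ge0// ltW.
have h1 : 0 <= (q + r) / 2 by lra.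
have h2 : (q + r) / 2 < r by lra.
have := key _ h1 h2.
rewrite -ler_pdivlMr// -[rnorm x / _]sqr_sqrtr ?divr_ge0 ?rnorm_ge0// -/q.
by rewrite ler_pXn2r ?nnegrE//; lra.
Qed.

(** * The unit ball of the [V]-seminorm and the entanglement measure *)

Lemma ballVP X : ballV V X <-> unitized_compact X /\ bounded_on V X 1.
Proof.
split=> [[cX XV]|[cX XV]]; split=> //.
  move=> x y Vx Vy; rewrite -lee_fin; apply: le_trans XV.
  by apply: ereal_sup_ubound; exists x => //; exists y.
by apply: ge_ereal_sup => _ [x Vx [y Vy <-]]; rewrite lee_fin; exact: XV.
Qed.

Lemma compact_ballV K : compact_operator K -> bounded_on V K 1 -> ballV V K.
Proof.
move=> cK KV; apply/ballVP; split=> //; exists K => //; exists 0.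
by rewrite scale0r addr0.
Qed.

Lemma entanglement_ge rho X : ballV V X ->
  ((rnorm (rho X))%:E <= entanglement_measure V rho)%E.
Proof. by move=> BX; apply: ereal_sup_ubound; exists X. Qed.

Lemma entanglement_le rho (c : \bar R) :
  (forall X, ballV V X -> ((rnorm (rho X))%:E <= c)%E) ->
  (entanglement_measure V rho <= c)%E.
Proof. by move=> h; apply: ge_ereal_sup => _ [X BX <-]; exact: h. Qed.

Lemma entanglement_ge0 rho : (0 <= entanglement_measure V rho)%E.
Proof.
have := @entanglement_ge rho 0; rewrite predual0 rnorm0; apply.
apply: compact_ballV; first exact: compact0.
by move=> x y _ _; rewrite inner0l rnorm0.
Qed.

Lemma entanglement_compact_ge (K : bop H) rho (c : R) : 0 < c ->
  compact_operator K -> bounded_on V K c ->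
  ((rnorm (rho K) / c)%:E <= entanglement_measure V rho)%E.
Proof.
move=> c0 cK KV.
have -> : rnorm (rho K) / c = rnorm (rho (c^-1%:C *: K)).
  by rewrite predualZ rnormM rnorm_real gtr0_norm ?invr_gt0// mulrC.
apply: entanglement_ge; apply: compact_ballV; first exact: compactZ.
move=> x y Vx Vy; rewrite innerZl rnormM rnorm_real gtr0_norm ?invr_gt0//.
by rewrite mulrC ler_pdivrMr// mul1r KV.
Qed.

Lemma predual_addE rho1 rho2 X : (rho1 + rho2) X = rho1 X + rho2 X.
Proof. by []. Qed.

Lemma predual_scaleE a rho X : (a *: rho) X = a * rho X.
Proof. by []. Qed.

Lemma entanglementD rho1 rho2 : (entanglement_measure V (rho1 + rho2)%R <=
  entanglement_measure V rho1 + entanglement_measure V rho2)%E.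
Proof.
apply: entanglement_le => X BX; rewrite predual_addE.
apply: le_trans (leeD (entanglement_ge rho1 BX) (entanglement_ge rho2 BX)).
by rewrite -EFinD lee_fin rnormD.
Qed.

Lemma entanglementZ a rho : a != 0 -> entanglement_measure V (a *: rho) =
  ((rnorm a)%:E * entanglement_measure V rho)%E.
Proof.
(* One inequality suffices: applied to [a^-1] and [a *: rho] it gives the other. *)
have le b sigma : b != 0 -> ((rnorm b)%:E * entanglement_measure V sigma <=
    entanglement_measure V (b *: sigma))%E.
  move=> b0; have pb : 0 < rnorm b by rewrite rnorm_gt0.
  rewrite muleC -lee_pdivlMr//; apply: entanglement_le => X BX.
  rewrite lee_pdivlMr// -EFinM.
  have -> : rnorm (sigma X) * rnorm b = rnorm ((b *: sigma) X).
    by rewrite predual_scaleE rnormM mulrC.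
  exact: entanglement_ge.
move=> a0; apply/eqP; rewrite eq_le le// andbT.
have pa : 0 < rnorm a by rewrite rnorm_gt0.
have := le a^-1 (a *: rho); rewrite invr_eq0 => /(_ a0).
rewrite scalerA mulVf// scale1r.
by rewrite rnormV lee_pdivrMl.
Qed.

(** Evaluation at a compact operator is weak* continuous, so a near-maximiser is first replaced by a
    compact [Y]. *)
Lemma entanglement_lsc :
  lower_semicontinuous (entanglement_measure V : weak_star H -> \bar R).
Proof.
move=> rho a aE.
have [a0|a0] := ltP a 0.
  exists setT; first exact: filterT.
  by move=> sigma _; apply: lt_le_trans (entanglement_ge0 _); rewrite lte_fin.
have [_ [X [[K cK [b XE]] XV] <-]] := ereal_sup_gt aE.
rewrite lte_fin => aX.
have {}XV : bounded_on V (K + b *: op1 H) 1.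
  have /ballVP[] // : ballV V (K + b *: op1 H).
  by rewrite -XE; split=> //; exists K => //; exists b.
(* This [e] ensures [a * (1 + e) < rnorm (rho X) - e], which survives both errors in passing from
   [X] to [Y]. *)
pose e := (rnorm (rho X) - a) / (2 + a).
have a2 : 0 < 2 + a by lra.
have e0 : 0 < e by rewrite divr_gt0// subr_gt0.
have [Y [cY YV rY]] := cutoff_predual rho V1 XV cK e0.
rewrite -XE in rY.
have e1 : 0 < 1 + e by lra.
have aY : a * (1 + e) < rnorm (rho Y).
  have := rnormB (rho Y) (rho Y - rho X); rewrite subKr.
  have : e * (2 + a) = rnorm (rho X) - a by rewrite /e divfK// gt_eqF.
  by nra.
exists [set sigma : weak_star H | a * (1 + e) < rnorm ((sigma : predual H) Y)].
  have cev : continuous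
      (fun sigma : weak_star H => (sigma : predual H) Y : R[i]^o).
    move=> sigma; apply: (@continuous_comp _ _ _
      (@weak_star_eval R H : weak_star H -> _)
      (fun f => f (exist _ Y cY))); first exact: initial_continuous.
    exact: ptws_eval_continuous.
  pose d := rnorm (rho Y) - a * (1 + e).
  have d0 : 0 < d%:C :> R[i] by rewrite ltr0c subr_gt0.
  have /cvgrPdist_lt /(_ _ d0) := cev rho.
  apply: filterS => sigma /=; rewrite rnormE ltcR /d => h.
  have := rnormD (rho Y - (sigma : predual H) Y) ((sigma : predual H) Y).
  by rewrite subrK; lra.
move=> sigma /= aS.
apply: lt_le_trans (entanglement_compact_ge (sigma : predual H) e1 cY YV).
by rewrite lte_fin ltr_pdivlMr.
Qed.

Lemma predual_norm_ge rho X : bop_le X 1 ->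
  ((rnorm (rho X))%:E <= predual_norm rho)%E.
Proof.
move=> X1; apply: ereal_sup_ubound; exists X => //=.
exact/opnorm_leP.
Qed.

Lemma predual_norm_fin rho : exists2 c : R, 0 <= c & predual_norm rho = c%:E.
Proof.
have [c c0 hc] := predual_bounded rho.
have n0 : (0 <= predual_norm rho)%E.
  have := @predual_norm_ge rho 0; rewrite predual0 rnorm0; apply.
  by move=> x; rewrite zero_bopE rnorm0 mul1r rnorm_ge0.
have nc : (predual_norm rho <= c%:E)%E.
  apply: ge_ereal_sup => _ [X /= X1 <-]; rewrite lee_fin -[c]mulr1.
  by apply: hc => //; apply/opnorm_leP.
case: (predual_norm rho) n0 nc => [n n0 _| |//];
  last by move=> _; rewrite leye_eq.
by exists n.
Qed.

Lemma rnorm_predual_le rho (n : R) X (M : R) : predual_norm rho = n%:E ->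
  0 < M -> bop_le X M -> rnorm (rho X) <= M * n.
Proof.
move=> rn M0 XM; have := @predual_norm_ge rho (M^-1%:C *: X).
rewrite rn predualZ rnormM rnorm_real gtr0_norm ?invr_gt0// lee_fin.
rewrite ler_pdivrMl//; apply => x.
rewrite scale_bopE rnormZ rnorm_real gtr0_norm ?invr_gt0// mul1r.
by rewrite ler_pdivrMl.
Qed.

(** Since [V] consists of unit vectors, compact contractions lie in [ballV V]; compressions of a
    contraction are such, and approximate it under [rho]. *)
Lemma predual_norm_le_entanglement rho :
  (predual_norm rho <= entanglement_measure V rho)%E.
Proof.
apply: ge_ereal_sup => _ [X /= X1 <-].
have {}X1 : bop_le X 1 by apply/opnorm_leP.
apply/lee_addgt0Pr => e e0.
have [s hs] := predual_compress rho X e0.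
have [P [fP Ps _]] := finproj_extend s (@finproj0 R H).
apply: (@le_trans _ _ ((rnorm (rho (compress P X)))%:E + e%:E)%E).
  rewrite -EFinD lee_fin.
  have := rnormB (rho (compress P X)) (rho (compress P X) - rho X).
  by rewrite subKr => /le_trans; apply; rewrite lerD2l hs.
rewrite leeD2r//; apply: entanglement_ge.
apply: compact_ballV; first exact: compress_compact.
move=> x y Vx Vy; rewrite -[1]mulr1; apply: rnorm_inner_le; last by rewrite V1.
by rewrite (le_trans (compress_le ler01 fP X1 x))// V1// mulr1.
Qed.

Lemma entanglement_le_predual_norm rho : 0 < r ->
  (entanglement_measure V rho <= (1 / r ^+ 2)%:E * predual_norm rho)%E.
Proof.
move=> r0; have [n n0 rn] := predual_norm_fin rho.
apply: entanglement_le => X /ballVP[_ XV]; rewrite rn -EFinM lee_fin.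
apply: rnorm_predual_le rn _ (bounded_on_bop_le r0 XV).
by rewrite divr_gt0// exprn_gt0.
Qed.

Lemma entanglement_equivalent_norm : 0 < r ->
  exists N : predual H -> R,
    [/\ forall rho, entanglement_measure V rho = (N rho)%:E, is_norm N &
      equivalent_norms N].
Proof.
move=> r0; pose N rho := fine (entanglement_measure V rho).
have EN rho : entanglement_measure V rho = (N rho)%:E.
  rewrite fineK// ge0_fin_numE ?entanglement_ge0//.
  apply: le_lt_trans (entanglement_le_predual_norm rho r0) _.
  by have [n _ ->] := predual_norm_fin rho; rewrite -EFinM ltry.
have N0 rho : (forall X, rho X = 0) -> rho = 0.
  by move=> h; apply/val_inj/funext.
exists N; split=> //.
- split=> [rho Nrho|a rho|rho1 rho2].
  + apply: N0 => X; have [M M0 XM] := bop_bounded X.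
    have [n n0 rn] := predual_norm_fin rho.
    have := rnorm_predual_le rn M0 XM.
    have := predual_norm_le_entanglement rho; rewrite EN rn lee_fin Nrho => n0'.
    have -> : n = 0 by apply/eqP; rewrite eq_le n0 n0'.
    by rewrite mulr0 => h; apply/eqP; rewrite -rnorm_eq0 eq_le h rnorm_ge0.
  (* [entanglementZ] excludes the scalar 0, where all values in the supremum vanish. *)
  + have [->|a0] := eqVneq a 0; last first.
      by apply: EFin_inj; rewrite EFinM -!EN entanglementZ.
    rewrite rnorm0 mul0r scale0r; apply: EFin_inj; rewrite -EN.
    apply/eqP; rewrite eq_le entanglement_ge0 andbT.
    by apply: entanglement_le => X _; rewrite lee_fin /= rnorm0.
  + by rewrite -lee_fin EFinD -!EN entanglementD.
- exists 1, (1 / r ^+ 2); split=> [//||rho].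
    by rewrite divr_gt0// exprn_gt0.
  rewrite mul1e -EN; split; first exact: predual_norm_le_entanglement.
  exact: entanglement_le_predual_norm.
Qed.

(* A separating functional [w] for a point outside the hull gives the rank one
   operator [w w^*], whose [V]-norm is at most [(s |w|)^2]. *)
Lemma ballV_large (s : R) : r < s ->
  exists X u, [/\ ballV V X, rnorm u = 1 & inner (X u) u = (1 / s ^+ 2)%:C].
Proof.
move=> rs; have s0 : 0 < s by exact: le_lt_trans inner_radius_ge0 rs.
have [x xs nx] := ball_not_sub_hull rs.
have [w w0 hw] := separation V1 V0 nx.
have pw : 0 < rnorm w by rewrite rnorm_gt0.
(* Invariance of [V] under phases turns the separating bound on real parts into one on moduli. *)
have hV v : V v -> rnorm (inner v w) <= s * rnorm w.
  move=> Vv; have [a a1 ha] := rnorm_phase (inner v w).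
  have := hw _ (phaseV a1 Vv); rewrite innerZl ha /= => /le_trans; apply.
  by rewrite (le_trans (ler_Re_rnorm _))// rnorm_inner_le.
pose u := (rnorm w)^-1%:C *: w.
have u1 : rnorm u = 1.
  by rewrite rnormZ rnorm_real gtr0_norm ?invr_gt0// mulVf ?gt_eqF.
have hu v : V v -> rnorm (inner v u) <= s.
  move=> Vv; rewrite innerZr conj_realC rnormM rnorm_real gtr0_norm ?invr_gt0//.
  by rewrite ler_pdivrMl// mulrC hV.
clearbody u; exists ((1 / s ^+ 2)%:C *: rank1 u u), u; split=> //.
- apply: compact_ballV; first by apply: compactZ; exact: compact_rank1.
  move=> v v' Vv Vv'; rewrite scale_bopE rank1E !innerZl !rnormM rnorm_real.
  rewrite gtr0_norm ?divr_gt0 ?exprn_gt0// mul1r ler_pdivrMl ?exprn_gt0// mulr1.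
  rewrite expr2 ler_pM ?rnorm_ge0 ?hu//.
  by rewrite innerC rnorm_conj hu.
- by rewrite scale_bopE rank1E !innerZl inner_self u1 expr1n !mulr1.
Qed.

Let value : \bar R := if r == 0 then +oo%E else (1 / r ^+ 2)%:E.

(** Passes to the limit [s -> r] in the lower bounds, covering [r = 0] as well: a finite [S] forces
    [r] to be positive. *)
Lemma le_radius_value (S : \bar R) :
  (forall s : R, r < s -> ((1 / s ^+ 2)%:E <= S)%E) -> (value <= S)%E.
Proof.
move=> h; have r0 := inner_radius_ge0.
have S0 : (0 <= S)%E.
  apply: le_trans (h (r + 1) _); last by rewrite ltrDl.
  by rewrite lee_fin divr_ge0// sqr_ge0.
case: S S0 h => [c| |//]; last by move=> *; exact: leey.
rewrite lee_fin => c0 h.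
have c0' : 0 < c.
  have rp : r < r + 1 by rewrite ltrDl.
  have := h _ rp; rewrite lee_fin; apply: lt_le_trans.
  by rewrite divr_gt0// exprn_gt0// (le_lt_trans r0 rp).
have q0 : 0 < Num.sqrt c by rewrite sqrtr_gt0.
have qc : Num.sqrt c ^+ 2 = c by rewrite sqr_sqrtr// ltW.
set q := Num.sqrt c in q0 qc.
(* Otherwise the midpoint [s] of [r] and [q^-1] would have [1 / s ^+ 2] above [c]. *)
have key : ~ (r < q^-1).
  move=> rq; pose s := (r + q^-1) / 2.
  have qi0 : 0 < q^-1 by rewrite invr_gt0.
  have s0 : 0 < s by rewrite divr_gt0// ltr_wpDl.
  have sq : s < q^-1 by rewrite /s; lra.
  have := h s; rewrite lee_fin => /(_ _); have rs : r < s by rewrite /s; lra.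
  move=> /(_ rs); rewrite -qc div1r.
  rewrite -[q ^+ 2]invrK lef_pV2 ?posrE ?invr_gt0 ?exprn_gt0// -exprVn.
  by rewrite ler_pXn2r ?nnegrE ?(ltW qi0) ?(ltW s0)// leNgt sq.
have {}key : q^-1 <= r by rewrite leNgt; apply/negP.
have rp : 0 < r by apply: lt_le_trans key; rewrite invr_gt0.
rewrite /value gt_eqF// lee_fin div1r -qc.
rewrite -[q ^+ 2]invrK lef_pV2 ?posrE ?invr_gt0 ?exprn_gt0// -exprVn.
by rewrite lerXn2r ?nnegrE ?invr_ge0 ?(ltW q0) ?(ltW rp).
Qed.

Lemma sup_states_value :
  ereal_sup [set entanglement_measure V rho | rho in @normal_state R H] = value.
Proof.
apply/eqP; rewrite eq_le; apply/andP; split.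
  rewrite /value; case: eqVneq => [_|r0]; first by rewrite leey.
  have {}r0 : 0 < r by rewrite lt_neqAle eq_sym r0 inner_radius_ge0.
  apply: ge_ereal_sup => _ [rho srho <-].
  apply: entanglement_le => X /ballVP[_ XV].
  rewrite lee_fin; apply: state_le => //; last exact: bounded_on_bop_le.
  by rewrite divr_ge0// sqr_ge0.
apply: le_radius_value => s rs; have [X [u [BX u1 Xu]]] := ballV_large rs.
apply: (@le_trans _ _ (entanglement_measure V (vector_functional u))).
  have := entanglement_ge (vector_functional u) BX.
  rewrite vector_functionalE Xu rnorm_real; apply: le_trans.
  by rewrite lee_fin ler_norm.
apply: ereal_sup_ubound; exists (vector_functional u) => //.
exact: vector_state.
Qed.

Lemma sup_opnorm_value : ereal_sup [set opnorm X | X in ballV V] = value.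
Proof.
apply/eqP; rewrite eq_le; apply/andP; split.
  rewrite /value; case: eqVneq => [_|r0]; first by rewrite leey.
  have {}r0 : 0 < r by rewrite lt_neqAle eq_sym r0 inner_radius_ge0.
  apply: ge_ereal_sup => _ [X /ballVP[_ XV] <-].
  apply/opnorm_leP; first by rewrite divr_ge0// sqr_ge0.
  exact: bounded_on_bop_le.
apply: le_radius_value => s rs; have [X [u [BX u1 Xu]]] := ballV_large rs.
apply: (@le_trans _ _ (opnorm X)); last by apply: ereal_sup_ubound; exists X.
apply: (@le_trans _ _ (rnorm (X u))%:E); last first.
  by apply: ereal_sup_ubound; exists u => //=; rewrite rnorm_le1 u1.
rewrite lee_fin; have := CauchySchwarz_rnorm (X u) u.
by rewrite Xu rnorm_real u1 mulr1; apply: le_trans; exact: ler_norm.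
Qed.

End Radius.

Theorem theorem5p3 (R : realType) (H : hilbertType R) (V : set H)
    (H_nonzero : exists x : H, x != 0)
    (V_unit : V `<=` [set x : H | `|x| = 1])
    (V_closed : closed V)
    (V1 : forall (a : R[i]) (x : H), `|a| = 1 -> V x -> V (a *: x))
    (V2 : forall x : H, (forall y : H, V y -> inner x y = 0) -> x = 0) :
  let E := entanglement_measure V in
  let r := inner_radius V in
  [/\ (forall rho1 rho2 : predual H, (E (rho1 + rho2)%R <= E rho1 + E rho2)%E),
      (forall (a : R[i]) (rho : predual H), a != 0 ->
         E (a *: rho)%R = ((rnorm a)%:E * E rho)%E),
      lower_semicontinuous (E : weak_star H -> \bar R),
      (0 < r ->
         exists N : predual H -> R,
           [/\ forall rho, E rho = (N rho)%:E, is_norm N & equivalent_norms N])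
    & ereal_sup [set E rho | rho in @normal_state R H]
        = ereal_sup [set opnorm X | X in ballV V] /\
      ereal_sup [set opnorm X | X in ballV V]
        = (if r == 0 then +oo%E else (1 / r ^+ 2)%:E)].
Proof.
move=> E r.
have V_rnorm v : V v -> rnorm v = 1 by move=> /V_unit /= v1; rewrite /rnorm v1.
have V_nonempty : V !=set0.
  (* Were [V] empty, [V2] would make every vector zero. *)
  have [x x0] := H_nonzero; apply: contrapT => V0; move/eqP: x0; apply.
  by apply: V2 => y Vy; exfalso; apply: V0; exists y.
split.
- exact: entanglementD.
- exact: entanglementZ.
- exact: entanglement_lsc.
- exact: entanglement_equivalent_norm.
- by rewrite sup_states_value ?sup_opnorm_value.
Qed.
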